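(* Let $\epsilon>0$ be an arbitrary constant. There exists a sequence $(\theta_r)$ of real numbers (depending only on $\epsilon$ and $r$), indexed by the integers $r\geq 1+\epsilon$, with $\lim_{r\to\infty}\theta_r=0$, such that for every integer $r\ge 1+\epsilon$ and every finite graph $G$ with minimum degree $r$, setting $p=\frac{1+\epsilon}{r}$, one has $$\mathbb{P}(G_p\text{ is planar})\leq \theta_r .$$
   Context: Graphs are finite and simple. For a graph $G=(V,E)$ and $0\le p\le 1$, $G_p=(V,E_p)$ denotes the random subgraph of $G$ on the same vertex set $V$ in which each edge $e\in E$ is included in $E_p$ independently with probability $p$. *)

(* Defs.v *)
From mathcomp Require Import all_boot all_order all_algebra.
From mathcomp Require Import all_classical all_reals all_analysis.
Import numFieldNormedType.Exports.
Import Order.TTheory GRing.Theory Num.Theory.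

Set Implicit Arguments.
Unset Strict Implicit.
Unset Printing Implicit Defensive.

Local Open Scope classical_set_scope.
Local Open Scope ring_scope.

Record sgraph (V : finType) := SGraph {
  edges : {set {set V}};
  edges_card2 : forall e, e \in edges -> #|e| = 2 }.

Definition degree (V : finType) (G : sgraph V) (v : V) : nat :=
  #|[set e in edges G | v \in e]|.

(* Every degree is smaller than [#|V|], so the default value only matters for
   the graph without vertices, whose minimum degree is [0] by convention. *)
Definition min_degree (V : finType) (G : sgraph V) : nat :=
  \big[minn/#|V|]_(v : V) degree G v.

Lemma edge_subgraph_card2 (V : finType) (G : sgraph V) (F : {set {set V}}) :
  forall e, e \in edges G :&: F -> #|e| = 2.
Proof. by move=> e /setIP[/edges_card2]. Qed.

Definition edge_subgraph (V : finType) (G : sgraph V) (F : {set {set V}}) :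
  sgraph V := SGraph (@edge_subgraph_card2 V G F).

(* Each edge is drawn as a simple arc parametrized by [0, 1]; the values of
   [arc e] outside [0, 1], or for [e] not an edge, are irrelevant. *)
Record plane_drawing (R : realType) (V : finType) (G : sgraph V)
    (pt : V -> R * R) (arc : {set V} -> R -> R * R) : Prop := PlaneDrawing {
  pt_inj : injective pt;
  arc_continuous : forall e, e \in edges G ->
    {within `[0, 1], continuous (arc e)};
  arc_inj : forall e, e \in edges G -> {in `[0, 1] &, injective (arc e)};
  arc_ends : forall e, e \in edges G ->
    arc e @` [set 0; 1] = pt @` [set` e];
  arc_avoids_pt : forall e (t : R) v, e \in edges G -> t \in `]0, 1[ ->
    arc e t <> pt v;
  arc_disjoint : forall e f (s t : R), e \in edges G -> f \in edges G -> e != f ->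
    s \in `]0, 1[ -> t \in `]0, 1[ -> arc e s <> arc f t }.

Definition planar (R : realType) (V : finType) (G : sgraph V) : Prop :=
  exists (pt : V -> R * R) (arc : {set V} -> R -> R * R),
    plane_drawing G pt arc.

(* The probability that the random subgraph G_p satisfies [P]: the sum, over
   the possible edge sets [F] of G_p, of the product Bernoulli(p) weights. *)
Definition prob_subgraph (R : realType) (V : finType) (p : R) (G : sgraph V)
    (P : sgraph V -> Prop) : R :=
  \sum_(F in powerset (edges G) | `[< P (edge_subgraph G F) >])
    \prod_(e in edges G) (if e \in F then p else 1 - p).

(* Main.v *)
(* Removing edges, assume that every edge has an endpoint of degree exactly [r],
   so that there are at most [r n] edges on [n] vertices, and call hubs the
   vertices of degree at least [M r].

   If a positive fraction of the vertices have many hub neighbours, expose these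
   vertices one by one. While the exposed graph is planar, its minor on the hubs
   is sparse, so each new vertex joins a new pair of hubs with probability bounded
   below; since [M] is large there are few hubs, and planarity soon fails.

   Otherwise delete the hubs and expose [G_p] in two rounds. A branching argument
   shows that in the first round most vertices lie in components of size at least
   [K] with probability bounded below independently of [K]; by the Harris and
   Efron-Stein inequalities a positive fraction of the edges has both ends in such
   components. Cut these components into at most [n / K] connected pieces, most of
   them of bounded size. The second round joins a number of pairs of pieces that is
   linear in [n], so for [K] large the minor on the pieces is too dense.

   A dense minor contains [K_5] (Mader), and a drawing of a graph with a [K_5] minor
   is excluded by counting crossing parities of discretized arcs (van Kampen). *)

Require Import Defs.
From mathcomp Require Import all_boot all_order all_algebra.
From mathcomp Require Import ring lra zify.
From Stdlib Require Import Bool Btauto.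
Import Order.TTheory GRing.Theory Num.Theory.

Set Implicit Arguments.
Unset Strict Implicit.
Unset Printing Implicit Defensive.


(** * Minors *)

Section Minors.
Variable V : finType.
Implicit Types (F : {set {set V}}) (A B : {set V}) (P Q : {set {set V}}).

(** The complete bipartite graph with sides [r] and [N], [N] huge, explains the case split: all its
    edges meet a hub, so no exploration avoiding the hubs can start. Conversely, sprinkling needs
    degrees of order [r], both to control the effect of one edge on the number of edges inside large
    components and to keep exponential moments of the degrees bounded. Any linear bound on the
    number of edges of a minor would serve in place of the planar one, because [K] is chosen after
    it. Sparsity in this sense passes to subgraphs, so edges of the base graph can be discarded
    freely. The bound must be uniform over all graphs. Of the order of the graph only [r <= #|V|] is
    known, so every error term has to vanish as [r] grows, either directly or through [#|V|]. *)

Definition erel F A : rel V := [rel x y | [&& x \in A, y \in A & [set x; y] \in F]].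
Definition conn F A : bool :=
  (A != set0) && [forall x in A, forall y in A, connect (erel F A) x y].
Definition touch F A B : bool := [exists x in A, exists y in B, [set x; y] \in F].

Lemma connP F A : reflect (A != set0 /\ forall x y, x \in A -> y \in A -> connect (erel F A) x y)
  (conn F A).
Proof.
apply: (iffP andP) => [[h0 h]|[h0 h]]; split=> //.
  by move=> x y xA yA; have /forall_inP/(_ x xA)/forall_inP/(_ y yA) := h.
by apply/forall_inP => x xA; apply/forall_inP => y yA; apply: h.
Qed.

Lemma touchP F A B : reflect (exists x y, [/\ x \in A, y \in B & [set x; y] \in F]) (touch F A B).
Proof.
apply: (iffP exists_inP) => [[x xA /exists_inP[y yB xy]]|[x [y [xA yB xy]]]].
  by exists x, y.
by exists x => //; apply/exists_inP; exists y.
Qed.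

End Minors.

(** * Minors of dense graphs *)

Section Mader.
Variable V : finType.
Implicit Types (F : {set {set V}}) (A B C : {set V}) (P Q R : {set {set V}}).

(** The members of a packing are the branch sets of a minor. Adjacencies are counted as ordered
    pairs: they form the degree sum of that minor. *)
Definition packing F P : bool := trivIset P && [forall A in P, conn F A].
Definition nbrs F P A : {set {set V}} := [set B in P | (B != A) && touch F A B].
Definition adjacencies F P : nat := \sum_(A in P) #|nbrs F P A|.
(* All that is used about planarity: a graph with a minor of average degree
   above 16 has a [K_5] minor. *)
Definition sparse F : bool :=
  [forall P : {set {set V}}, packing F P ==> (adjacencies F P <= 16 * #|P|)].

Lemma touch_sym F A B : touch F A B = touch F B A.
Proof.
by apply/touchP/touchP => -[x [y [h1 h2 h3]]]; exists y, x; rewrite setUC.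
Qed.

Lemma touch_sub F A A' B B' : A \subset A' -> B \subset B' -> touch F A B -> touch F A' B'.
Proof.
move=> /subsetP sA /subsetP sB /touchP[x [y [xA yB h]]]; apply/touchP.
by exists x, y; rewrite sA ?sB.
Qed.

Lemma packing_sub F P Q : Q \subset P -> packing F P -> packing F Q.
Proof.
move=> QP /andP[tP /forall_inP cP]; apply/andP; split; first exact: trivIsetS tP.
by apply/forall_inP => A /(subsetP QP)/cP.
Qed.

Lemma conn_neq0 F A : conn F A -> A != set0.
Proof. by case/andP. Qed.

Lemma erel_sub F A B : A \subset B -> subrel (connect (erel F A)) (connect (erel F B)).
Proof.
move=> AB; apply: connect_sub => x y /and3P[xA yA h]; apply: connect1.
by rewrite /erel /= !(subsetP AB) //.
Qed.

Lemma conn_setU F A B : conn F A -> conn F B -> touch F A B -> conn F (A :|: B).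
Proof.
move=> /connP[A0 cA] /connP[B0 cB] /touchP[x [y [xA yB xy]]]; apply/connP; split.
  by apply/set0Pn; exists x; rewrite inE xA.
have sA := @erel_sub F _ _ (subsetUl A B).
have sB := @erel_sub F _ _ (subsetUr A B).
have h1 : connect (erel F (A :|: B)) x y by apply: connect1; rewrite /erel /= !inE xA yB orbT.
have h2 : connect (erel F (A :|: B)) y x.
  by apply: connect1; rewrite /erel /= !inE xA yB orbT setUC.
move=> u v; rewrite !inE => /orP[uA|uB] /orP[vA|vB].
- by apply/sA/cA.
- apply: connect_trans (sA _ _ (cA _ _ uA xA)) _; apply: connect_trans h1 _.
  by apply/sB/cB.
- apply: connect_trans (sB _ _ (cB _ _ uB yB)) _; apply: connect_trans h2 _.
  by apply/sA/cA.
- by apply/sB/cB.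
Qed.

Lemma adjacencies_setU1 F R A : A \notin R ->
  adjacencies F (A |: R) = adjacencies F R + 2 * #|nbrs F R A|.
Proof.
move=> AR; rewrite /adjacencies big_setU1//=.
have -> : nbrs F (A |: R) A = nbrs F R A.
  by apply/setP => B; rewrite !inE; case: eqVneq => //= ->; rewrite andbF.
rewrite (eq_bigr (fun B => #|nbrs F R B| + (touch F A B : nat))); last first.
  move=> B BR; have AB : A != B by apply: contraNneq AR => ->.
  rewrite (cardsD1 A) !inE eqxx AB /= touch_sym addnC; congr (_ + _); apply: eq_card => C.
  rewrite !inE; case: eqVneq => //= ->; by rewrite (negbTE AR).
rewrite big_split /=.
suff -> : \sum_(B in R) (touch F A B : nat) = #|nbrs F R A|.
  by rewrite mul2n -addnn addnCA.
rewrite -sum1_card big_mkcond [RHS]big_mkcond; apply: eq_bigr => B _.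
rewrite !inE; case: (boolP (B \in R)) => //= BR.
have -> : B != A by apply: contraNneq AR => <-.
by case: touch.
Qed.

Lemma touch_setU F A B C : touch F (A :|: B) C = touch F A C || touch F B C.
Proof.
apply/touchP/orP => [[x [y [xU yC xy]]]|[] h].
- by move: xU; rewrite inE => /orP[] h; [left|right]; apply/touchP; exists x, y.
- by apply/touchP; apply: touch_sub h => //; apply: subsetUl.
- by apply/touchP; apply: touch_sub h => //; apply: subsetUr.
Qed.

(** The last clause serves the induction on [t]: staying inside [cover P] keeps the model disjoint
    from one more branch set, and containing a member of [P] makes it touch whatever that member
    touches. *)
Definition K_model F P t s : Prop := [/\ size s = t, all (conn F) s,
  pairwise (fun A B => [disjoint A & B] && touch F A B) s &
  forall B, B \in s -> B \subset cover P /\ exists2 A, A \in P & A \subset B].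

(* Merging two touching members with few common neighbours keeps the density,
   and otherwise the neighbourhood of any member is dense. *)
Lemma mader F t P : packing F P -> P != set0 -> 2 ^ t * #|P| <= adjacencies F P ->
  exists s, K_model F P t.+1 s.
Proof.
elim: t P => [|t IHt] P.
  move=> /andP[_ /forall_inP cP] /set0Pn[A AP] _; exists [:: A]; split=> //=.
    by rewrite andbT cP.
  by move=> B; rewrite inE => /eqP->; split; [exact: (bigcup_sup A)|exists A].
have [n] := ubnP #|P|; elim: n P => // n IHn P Pn pP P0 dP.
have /andP[tP /forall_inP cP] := pP.
set k := 2 ^ t; rewrite expnS -/k in dP.
have dis A B : A \in P -> B \in P -> A != B -> [disjoint A & B].
  by move=> AP BP; move/trivIsetP: tP; apply.
case: (boolP [exists A in P, exists B in P, [&& A != B, touch F A B &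
    #|nbrs F P A :&: nbrs F P B| < k]]) => [|nex].
- move=> /exists_inP[A AP /exists_inP[B BP /and3P[AB tAB cAB]]].
  pose R := P :\ A :\ B.
  have AR : A \notin B |: R by rewrite !inE eqxx (negbTE AB) andbF.
  have BR : B \notin R by rewrite !inE eqxx.
  have PE : P = A |: (B |: R).
    by apply/setP => C; rewrite !inE; case: (eqVneq C A) => [->|_] //=; case: (eqVneq C B) => [->|_].
  have RP : R \subset P by rewrite PE; apply/subsetP => C CR; rewrite !inE in CR *; rewrite CR !orbT.
  pose U := A :|: B.
  have disU C : C \in R -> [disjoint U & C].
    rewrite !inE => /and3P[CB CA CP]; rewrite disjoints_subset subUset -!disjoints_subset.
    by rewrite (dis A C AP CP) 1?(dis B C BP CP) // eq_sym.
  have A0 := conn_neq0 (cP A AP).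
  have UR : U \notin R.
    apply/negP => /disU; rewrite -setI_eq0 setIid setU_eq0 (negbTE A0) //.
  have pP' : packing F (U |: R).
    apply/andP; split.
      apply/trivIsetP => C D; rewrite !inE => /orP[/eqP->|CR] /orP[/eqP->|DR] CD.
      + by rewrite eqxx in CD.
      + by apply: disU; rewrite !inE.
      + by rewrite disjoint_sym; apply: disU; rewrite !inE.
      + by apply: dis => //; [case/and3P: CR|case/and3P: DR].
    apply/forall_inP => C; rewrite inE in_set1 => /orP[/eqP->|/(subsetP RP)/cP//].
    by apply: conn_setU; rewrite ?cP.
  have cE : #|U |: R| = #|P|.-1 by rewrite PE !cardsU1 UR AR BR.
  have [] := IHn (U |: R).
  + have : 0 < #|P| by rewrite card_gt0.
    by rewrite cE; move: Pn; clear; lia.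
  + by [].
  + by apply/set0Pn; exists U; rewrite !inE eqxx.
  + have nU : nbrs F R U = nbrs F R A :|: nbrs F R B.
      apply/setP => C; rewrite !inE touch_setU; case: (boolP (C \in R)) => CR //; last first.
        by move: CR; rewrite !inE => /negbTE->.
      have -> : C != U by apply: contraNneq UR => <-.
      by move: CR; rewrite !inE => /and3P[-> -> ->].
    have nA : nbrs F (B |: R) A = B |: nbrs F R A.
      apply/setP => C; rewrite !inE; case: (eqVneq C B) => [->|] //=.
      by rewrite eq_sym AB tAB.
    have BnA : B \notin nbrs F R A by rewrite !inE eqxx.
    have nI : nbrs F R A :&: nbrs F R B = nbrs F P A :&: nbrs F P B.
      by apply/setP => C; rewrite !inE; case: (C \in P); case: (C != A); case: (C != B); rewrite ?andbF.
    (* Merging loses the adjacency of [A] and [B] and one per common neighbour, each counted twice: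
       at most [2 * k], which is exactly what one member fewer allows. *)
    have := cardsUI (nbrs F R A) (nbrs F R B); rewrite -nU nI => cU.
    have := dP; rewrite [in adjacencies _ _]PE !adjacencies_setU1// nA cardsU1 BnA cE.
    have : 0 < #|P| by rewrite card_gt0.
    by rewrite expnS -/k; move: cAB cU; clear; nia.
  have UP : U \subset cover P by rewrite subUset !(bigcup_sup _ AP, bigcup_sup _ BP).
  move=> s [ss sc sp sP]; exists s; split=> // D /sP[Ds [C CU CD]]; split.
    apply: subset_trans Ds _; apply/bigcupsP => E; rewrite inE in_set1 => /orP[/eqP->//|ER].
    by apply: bigcup_sup; apply: (subsetP RP).
  move: CU; rewrite inE in_set1 => /orP[/eqP CU|CR]; last by exists C => //; apply: (subsetP RP).
  by exists A => //; apply: subset_trans CD; rewrite CU subsetUl.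
- have k0 : 0 < k by rewrite expn_gt0.
  have com A B : A \in P -> B \in P -> A != B -> touch F A B ->
      k <= #|nbrs F P A :&: nbrs F P B|.
    move=> AP BP AB tAB; rewrite leqNgt; apply: contra nex => h.
    by apply/exists_inP; exists A => //; apply/exists_inP; exists B => //; rewrite AB tAB.
  have [A AP nA0] : exists2 A, A \in P & nbrs F P A != set0.
    apply/exists_inP; apply: contraTT dP => /exists_inPn h; rewrite -ltnNge.
    rewrite /adjacencies big1 => [|A /h]; first by rewrite !muln_gt0 k0 card_gt0.
    by rewrite negbK => /eqP->; rewrite cards0.
  pose N := nbrs F P A.
  have NP : N \subset P by apply/subsetP => C; rewrite inE => /andP[].
  have [s [ss sc sp sP]] : exists s, K_model F N t.+1 s.
    apply: IHt => //; first exact: packing_sub pP.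
    rewrite mulnC -sum_nat_const; apply: leq_sum => B BN.
    move: (BN); rewrite inE => /and3P[BP BA tAB].
    apply: leq_trans (com A B AP BP _ tAB) _; first by rewrite eq_sym.
    by apply: subset_leq_card; apply/subsetP => C; rewrite !inE => /andP[-> /and3P[_ -> ->]].
  have AN B : B \in s -> [disjoint A & B] && touch F A B.
    move=> /sP[BN [C CN CB]]; apply/andP; split.
      rewrite disjoint_sym; apply: disjointWl BN _; rewrite disjoint_sym.
      rewrite disjoints_subset; apply/subsetP => x xA; rewrite inE; apply/bigcupP => -[D].
      rewrite inE => /and3P[DP DA _] xD.
      by have := dis D A DP AP DA => /disjointFr/(_ xD); rewrite xA.
    by move: CN; rewrite inE => /and3P[_ _ tAC]; apply: touch_sub tAC.
  exists (A :: s); split=> /=; first by rewrite ss.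
  + by rewrite cP.
  + by rewrite sp andbT; apply/allP.
  + move=> B; rewrite inE => /orP[/eqP->|/sP[BN [C CN CB]]].
      by split; [exact: (bigcup_sup A)|exists A].
    split; last by exists C => //; apply: (subsetP NP).
    by apply: subset_trans BN _; apply/bigcupsP => D DN; apply: bigcup_sup; apply: (subsetP NP).
Qed.

Lemma sparse_sub F F' : F \subset F' -> sparse F' -> sparse F.
Proof.
move=> FF /forall_inP h; apply/forall_inP => P pP.
have cs A : subrel (connect (erel F A)) (connect (erel F' A)).
  apply: connect_sub => x y /and3P[xA yA xy]; apply: connect1.
  by rewrite /erel /= xA yA (subsetP FF).
have pP' : packing F' P.
  case/andP: pP => tP /forall_inP cP; apply/andP; split=> //; apply/forall_inP => A /cP.
  by move=> /connP[A0 cA]; apply/connP; split=> // x y xA yA; apply: cs; apply: cA.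
apply: leq_trans (h P pP'); apply: leq_sum => A AP; apply: subset_leq_card.
apply/subsetP => B; rewrite !inE => /and3P[-> -> /touchP[x [y [xA yB xy]]]] /=.
by apply/touchP; exists x, y; rewrite (subsetP FF).
Qed.

(** The constant 16 is [2 ^ 4]: each of the four steps from [K_1] to [K_5] doubles the density
    required. *)
Lemma not_sparse_K5 F : ~~ sparse F -> exists s, exists P, K_model F P 5 s.
Proof.
rewrite negb_forall_in => /exists_inP[P pP]; rewrite -ltnNge => h.
have P0 : P != set0 by apply: contraTneq h => ->; rewrite /adjacencies big_set0 ltn0.
by have [s hs] := @mader F 4 P pP P0 (ltnW h); exists s, P.
Qed.

End Mader.

(** * Expectation over the random edge set *)

Section Expectation.
Local Open Scope ring_scope.
Variables (R : realFieldType) (T : finType).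
Implicit Types (p x c : R) (S A F : {set T}) (f g : {set T} -> R) (e : T).

Definition wt p S F : R := \prod_(e in S) (if e \in F then p else 1 - p).

Definition EE p S f : R := \sum_(F in powerset S) wt p S F * f F.

Lemma EE_set0 p f : EE p set0 f = f set0.
Proof.
by rewrite /EE powerset0 big_set1 /wt big_set0 mul1r.
Qed.

(** Conditioning on one element. With [set_peel_ind] it turns independence statements into
    inductions over [S]. *)
Lemma EE_peel p S f e : e \in S ->
  EE p S f = p * EE p (S :\ e) (fun F => f (e |: F)) + (1 - p) * EE p (S :\ e) f.
Proof.
move=> eS; rewrite /EE (bigID (fun F : {set T} => e \in F)) /=; congr (_ + _).
- rewrite (reindex_onto (fun F => e |: F) (fun F => F :\ e)); last first.
    by move=> F /andP[_ eF]; rewrite setD1K.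
  rewrite big_distrr /=; apply: eq_big => F.
    rewrite !powersetE setU11 andbT subUset sub1set eS /= subsetD1; congr (_ && _).
    apply/eqP/idP => [<-|eF]; first by rewrite setD11.
    by rewrite setU1K.
  rewrite !powersetE => /andP[/andP[sF _] /eqP hF].
  rewrite mulrA; congr (_ * _).
  rewrite /wt (bigD1 e)//= setU11; congr (_ * _).
  apply: eq_big => [u|u /andP[uS ue]]; first by rewrite !inE andbC.
  by rewrite !inE (negbTE ue).
- rewrite big_distrr /=; apply: eq_big => F.
    by rewrite !powersetE subsetD1.
  rewrite powersetE => /andP[sF eF].
  rewrite mulrA; congr (_ * _).
  rewrite /wt (bigD1 e)//= (negbTE eF); congr (_ * _).
  by apply: eq_bigl => u; rewrite !inE andbC.
Qed.

Lemma set_peel_ind (P : {set T} -> Prop) : P set0 ->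
  (forall S e, e \in S -> P (S :\ e) -> P S) -> forall S, P S.
Proof.
move=> P0 Pe S; have [n] := ubnP #|S|; elim: n S => // n IH S hS.
have [->//|/set0Pn[e eS]] := eqVneq S set0.
apply: (Pe _ e eS); apply: IH.
by move: hS; rewrite (cardsD1 e S) eS.
Qed.

Lemma eq_EE p S f g : (forall F, F \subset S -> f F = g F) -> EE p S f = EE p S g.
Proof. by move=> h; apply: eq_bigr => F; rewrite powersetE => /h->. Qed.

Lemma EE_cst p S c : EE p S (fun=> c) = c.
Proof.
elim/set_peel_ind: S => [|S e eS IH]; first by rewrite EE_set0.
by rewrite (EE_peel _ _ eS) IH; ring.
Qed.

Lemma EE_D p S f g : EE p S (fun F => f F + g F) = EE p S f + EE p S g.
Proof. by rewrite /EE -big_split; apply: eq_bigr => F _; rewrite mulrDr. Qed.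

Lemma EE_Z p S c f : EE p S (fun F => c * f F) = c * EE p S f.
Proof. by rewrite /EE big_distrr; apply: eq_bigr => F _; rewrite mulrCA. Qed.

Lemma EE_sum p S (I : Type) (r : seq I) (P : pred I) (f : I -> {set T} -> R) :
  EE p S (fun F => \sum_(i <- r | P i) f i F) = \sum_(i <- r | P i) EE p S (f i).
Proof.
rewrite /EE exchange_big; apply: eq_bigr => F _.
by rewrite big_distrr.
Qed.

Lemma wt_ge0 p S F : 0 <= p <= 1 -> 0 <= wt p S F.
Proof.
move=> /andP[p0 p1]; apply: prodr_ge0 => e _.
by case: ifP => // _; rewrite subr_ge0.
Qed.

Lemma EE_le p S f g : 0 <= p <= 1 -> (forall F, F \subset S -> f F <= g F) ->
  EE p S f <= EE p S g.
Proof.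
move=> hp h; apply: ler_sum => F; rewrite powersetE => FS.
by rewrite ler_wpM2l ?wt_ge0// h.
Qed.

Lemma EE_ge0 p S f : 0 <= p <= 1 -> (forall F, F \subset S -> 0 <= f F) ->
  0 <= EE p S f.
Proof. by move=> hp h; rewrite -(EE_cst p S 0); apply: EE_le. Qed.

Lemma EE_split p S A f : A \subset S ->
  EE p S f = EE p A (fun F1 => EE p (S :\: A) (fun F2 => f (F1 :|: F2))).
Proof.
elim/set_peel_ind: A S f => [|A e eA IH] S f AS.
  by rewrite EE_set0 setD0; apply: eq_EE => F _; rewrite set0U.
have eS := subsetP AS e eA.
rewrite (EE_peel _ _ eS) (EE_peel _ _ eA).
have sub : A :\ e \subset S :\ e by apply: setSD.
rewrite !(IH _ _ sub).
have -> : (S :\ e) :\: (A :\ e) = S :\: A.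
  apply/setP => u; rewrite !inE negb_and negbK.
  by case: eqVneq => [->|_] //=; rewrite eA.
congr (_ * _ + _).
by apply: eq_EE => F1 _; apply: eq_EE => F2 _; rewrite setUA.
Qed.

Lemma EE_rounds p p1 p2 S f : 1 - p = (1 - p1) * (1 - p2) ->
  EE p S f = EE p1 S (fun F1 => EE p2 S (fun F2 => f (F1 :|: F2))).
Proof.
move=> hp; have hp' : p = p1 + p2 - p1 * p2 by lra.
elim/set_peel_ind: S f => [|S e eS IH] f; first by rewrite !EE_set0 set0U.
rewrite !(EE_peel _ _ eS) !IH.
rewrite [EE p1 _ (fun F1 => EE p2 S (fun F2 => f (e |: F1 :|: F2)))](_ : _ =
   EE p1 (S :\ e) (fun F1 => EE p2 (S :\ e) (fun F2 => f (e |: (F1 :|: F2))))); last first.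
  apply: eq_EE => F1 _; rewrite (EE_peel _ _ eS) -[RHS]mul1r.
  rewrite [X in _ * X + _](_ : _ = EE p2 (S :\ e) (fun F2 => f (e |: (F1 :|: F2)))).
    rewrite [X in _ + _ * X](_ : _ = EE p2 (S :\ e) (fun F2 => f (e |: (F1 :|: F2)))).
      by ring.
    by apply: eq_EE => F _; rewrite setUA.
  by apply: eq_EE => F _; congr f; apply/setP => u; rewrite !inE; case: (u == e).
rewrite [EE p1 _ (fun F1 => EE p2 S _)](_ : _ =
   p2 * EE p1 (S :\ e) (fun F1 => EE p2 (S :\ e) (fun F2 => f (e |: (F1 :|: F2)))) +
   (1 - p2) * EE p1 (S :\ e) (fun F1 => EE p2 (S :\ e) (fun F2 => f (F1 :|: F2)))).
  by rewrite hp'; ring.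
rewrite -!EE_Z -EE_D; apply: eq_EE => F1 _; rewrite (EE_peel _ _ eS).
congr (_ * _ + _).
by apply: eq_EE => F _; congr f; rewrite setUCA.
Qed.

(** Applied to [sparse]: deleting edges from the base graph can only raise the probability to be
    bounded. *)
Lemma EE_antimono p S A f : 0 <= p <= 1 -> A \subset S ->
  (forall F1 F2, F1 \subset F2 -> f F2 <= f F1) -> EE p S f <= EE p A f.
Proof.
move=> hp AS hf; rewrite (EE_split _ _ AS); apply: EE_le => // F1 _.
rewrite -[leRHS](EE_cst p (S :\: A)); apply: EE_le => // F2 _.
by apply: hf; apply: subsetUl.
Qed.

(** Conditioning on [e] adds to the covariance the term [p * (1 - p)] times the product of the
    increments of the two means, and both increments are nonnegative by monotonicity. *)
Lemma EE_harris p S f g : 0 <= p <= 1 ->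
  (forall F1 F2, F1 \subset F2 -> f F1 <= f F2) ->
  (forall F1 F2, F1 \subset F2 -> g F1 <= g F2) ->
  EE p S f * EE p S g <= EE p S (fun F => f F * g F).
Proof.
move=> hp; have /andP[p0 p1] := hp.
elim/set_peel_ind: S f g => [|S e eS IH] f g hf hg; first by rewrite !EE_set0.
rewrite !(EE_peel _ _ eS).
have hU h : (forall F1 F2 : {set T}, F1 \subset F2 -> h F1 <= h F2 :> R) ->
  (forall F1 F2, F1 \subset F2 -> h (e |: F1) <= h (e |: F2)).
  by move=> hh F1 F2 s; apply: hh; apply: setUS.
have a1 := IH _ _ (hU _ hf) (hU _ hg); have a0 := IH _ _ hf hg.
have b1 : EE p (S :\ e) f <= EE p (S :\ e) (fun F => f (e |: F)).
  by apply: EE_le => // F _; apply: hf; apply: subsetUr.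
have b0 : EE p (S :\ e) g <= EE p (S :\ e) (fun F => g (e |: F)).
  by apply: EE_le => // F _; apply: hg; apply: subsetUr.
move: a1 a0 b1 b0.
move: (EE _ _ (fun F => f (e |: F) * _)) (EE _ _ (fun F => f F * _)) => X Y.
move: (EE p (S :\ e) f) (EE p (S :\ e) g) (EE p _ (fun F => f (e |: F))) (EE p _ (fun F => g (e |: F))) => a b c d.
move=> a1 a0 b1 b0.
have h1 : p * (c * d) <= p * X by rewrite ler_wpM2l.
have h2 : (1 - p) * (a * b) <= (1 - p) * Y by rewrite ler_wpM2l// subr_ge0.
have h3 : 0 <= p * (1 - p) * ((c - a) * (d - b)).
  by rewrite !mulr_ge0// subr_ge0.
apply: le_trans (lerD h1 h2); rewrite -subr_ge0; apply: le_trans h3 _.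
by rewrite le_eqVlt; apply/orP; left; apply/eqP; ring.
Qed.

(* Efron-Stein, by conditioning on one element at a time. *)
Lemma EE_variance p S c f : 0 <= p <= 1 -> 0 <= c ->
  (forall F e, e \in S -> `|f (e |: F) - f F| <= c) ->
  EE p S (fun F => f F ^+ 2) - EE p S f ^+ 2 <= #|S|%:R * p * c ^+ 2.
Proof.
move=> hp c0; have /andP[p0 p1] := hp.
elim/set_peel_ind: S f => [|S e eS IH] f hf; first by rewrite !EE_set0 cards0 subrr !mul0r.
rewrite !(EE_peel _ _ eS) (cardsD1 e S) eS add1n -natr1.
have sub u : u \in S :\ e -> u \in S by rewrite inE => /andP[].
have hf1 F u : u \in S :\ e -> `|f (e |: (u |: F)) - f (e |: F)| <= c.
  by move=> /sub uS; rewrite setUCA; apply: hf.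
have a1 := IH (fun F => f (e |: F)) hf1.
have a0 := IH f (fun F u uS => hf F u (sub u uS)).
have : `|EE p (S :\ e) (fun F => f (e |: F)) - EE p (S :\ e) f| <= c.
  rewrite -mulN1r -EE_Z -EE_D.
  have hn F : - c <= f (e |: F) + -1 * f F <= c by rewrite -ler_norml mulN1r; apply: hf.
  rewrite ler_norml; apply/andP; split.
    by rewrite -[leLHS](EE_cst p (S :\ e)); apply: EE_le => // F _; have /andP[] := hn F.
  by rewrite -[leRHS](EE_cst p (S :\ e)); apply: EE_le => // F _; have /andP[] := hn F.
move: a0 a1.
move: (EE _ _ (fun F => f (e |: F) ^+ 2)) (EE _ _ (fun F => f F ^+ 2)) => X Y.
move: (EE p (S :\ e) (fun F => f (e |: F))) (EE p (S :\ e) f) => a b.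
move=> a0 a1 hab.
have h1 : p * (X - a ^+ 2) <= p * (#|S :\ e|%:R * p * c ^+ 2) by rewrite ler_wpM2l.
have h2 : (1 - p) * (Y - b ^+ 2) <= (1 - p) * (#|S :\ e|%:R * p * c ^+ 2).
  by rewrite ler_wpM2l// subr_ge0.
have h3 : (a - b) ^+ 2 <= c ^+ 2.
  by rewrite -real_normK ?num_real// ler_sqr ?nnegrE.
have h4 : p * (1 - p) * (a - b) ^+ 2 <= p * c ^+ 2.
  apply: (@le_trans _ _ (p * (1 - p) * c ^+ 2)).
    by apply: ler_wpM2l => //; rewrite mulr_ge0// subr_ge0.
  apply: ler_wpM2r; first exact: sqr_ge0.
  by rewrite ler_piMr// gerBl.
have -> : p * X + (1 - p) * Y - (p * a + (1 - p) * b) ^+ 2 =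
  p * (X - a ^+ 2) + (1 - p) * (Y - b ^+ 2) + p * (1 - p) * (a - b) ^+ 2 by ring.
apply: le_trans (lerD (lerD h1 h2) h4) _.
by rewrite le_eqVlt; apply/orP; left; apply/eqP; ring.
Qed.

(** Only a lower bound [mu] on the mean is at hand, but a value below [mu / 2] still deviates from
    the mean by at least [mu / 2]. *)
Lemma EE_chebyshev p S c f (mu : R) : 0 <= p <= 1 -> 0 <= c -> 0 < mu ->
  (forall F e, e \in S -> `|f (e |: F) - f F| <= c) -> mu <= EE p S f ->
  EE p S (fun F => (f F < mu / 2)%R%:R) <= 4 * (#|S|%:R * p * c ^+ 2) / mu ^+ 2.
Proof.
move=> hp c0 mu0 hf hmu; set m := EE p S f in hmu.
have mu2 : 0 < mu ^+ 2 by apply: exprn_gt0.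
rewrite ler_pdivlMr//.
apply: (@le_trans _ _ (4 * EE p S (fun F => (f F - m) ^+ 2))).
  rewrite mulrC -!EE_Z; apply: EE_le => // F _.
  case: ltP => /= h; last by rewrite mulr0 mulr_ge0// sqr_ge0.
  rewrite mulr1 (_ : mu ^+ 2 = 4 * (mu / 2) ^+ 2); last by field.
  rewrite ler_wpM2l// -[leRHS]sqrrN ler_sqr ?nnegrE; lra.
rewrite ler_wpM2l//; apply: le_trans (EE_variance hp c0 hf).
rewrite le_eqVlt; apply/orP; left; apply/eqP.
rewrite (eq_EE _ (g := fun F => f F ^+ 2 + (- (2 * m)) * f F + m ^+ 2)); last first.
  by move=> F _; ring.
by rewrite !EE_D EE_Z EE_cst -/m; ring.
Qed.

(** The generating function of a binomial variable, used at a general [x] for the branching process,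
    at 2 for degree moments and at 0 for the absence of edges. *)
Lemma EE_pow p S A x : A \subset S ->
  EE p S (fun F => x ^+ #|F :&: A|) = (1 - p + p * x) ^+ #|A|.
Proof.
elim/set_peel_ind: S A => [|S e eS IH] A AS.
  by move: AS; rewrite subset0 => /eqP->; rewrite EE_set0 set0I cards0 !expr0.
rewrite (EE_peel _ _ eS).
case: (boolP (e \in A)) => eA.
  have sub : A :\ e \subset S :\ e by apply: setSD.
  rewrite (eq_EE _ (g := fun F => x * x ^+ #|F :&: (A :\ e)|)).
    rewrite [X in _ + _ * X](eq_EE _ (g := fun F => x ^+ #|F :&: (A :\ e)|)).
      by rewrite EE_Z IH// (cardsD1 e A) eA exprS; ring.
    move=> F; rewrite subsetD1 => /andP[_ eF]; congr (_ ^+ #|pred_of_set _|).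
    by apply/setP => u; rewrite !inE; case: eqVneq => // ->; rewrite (negbTE eF).
  move=> F; rewrite subsetD1 => /andP[_ eF]; rewrite -exprS (cardsD1 e (_ :&: A)).
  rewrite !inE eqxx eA /= add1n; congr (_ ^+ #|pred_of_set _|.+1).
  by apply/setP => u; rewrite !inE; case: eqVneq; rewrite /= ?andbF.
have sub : A \subset S :\ e by rewrite subsetD1 AS.
rewrite (eq_EE _ (g := fun F => x ^+ #|F :&: A|)).
  by rewrite IH//; ring.
move=> F; rewrite subsetD1 => /andP[_ eF]; congr (_ ^+ #|pred_of_set _|).
by apply/setP => u; rewrite !inE; case: eqVneq => // ->; rewrite (negbTE eA) !andbF.
Qed.


End Expectation.

(** * Components and pieces *)

Section Exploration.
Local Open Scope ring_scope.
Variables (R : realFieldType) (V : finType).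
Implicit Types (E F S A : {set {set V}}) (N Q U : {set V}) (u v w : V).

Definition adj F : rel V := [rel x y | [set x; y] \in F].
Definition component F v : {set V} := [set u | connect (adj F) v u].
Definition star u N : {set {set V}} := [set [set u; w] | w in N].

Lemma set2_inj u w w' : w != u -> [set u; w] = [set u; w'] -> w = w'.
Proof.
move=> wu /setP/(_ w); rewrite !inE eqxx orbT (negbTE wu) /= => /esym/eqP; exact.
Qed.

Lemma card_star u N : u \notin N -> #|star u N| = #|N|.
Proof.
move=> uN; apply: card_in_imset => w w' wN _; apply: set2_inj.
by apply: contraNneq uN => <-.
Qed.

Lemma adj_sym F : symmetric (adj F).
Proof. by move=> x y; rewrite /adj /= setUC. Qed.

Lemma adj_sub F F' : F \subset F' -> subrel (connect (adj F)) (connect (adj F')).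
Proof.
move=> /subsetP FF; apply: connect_sub => x y xy; apply: connect1; exact: FF.
Qed.

Lemma component_sub F F' v : F \subset F' -> component F v \subset component F' v.
Proof. by move=> FF; apply/subsetP => u; rewrite !inE; apply: adj_sub. Qed.

Lemma exists_subset_card (T : finType) (A : {set T}) n : (n <= #|A|)%N ->
  exists2 B : {set T}, B \subset A & #|B| = n.
Proof.
move=> nA; exists [set x in take n (enum A)].
  by apply/subsetP => x; rewrite inE => /mem_take; rewrite mem_enum.
rewrite cardsE; have /card_uniqP -> : uniq (take n (enum A)) by rewrite take_uniq// enum_uniq.
by rewrite size_takel// -cardE.
Qed.

(** By [dx] the generating function of Binomial(d, p) is at most [x] at [x], so [x] bounds the
    extinction probability of the branching process with this offspring law. The index of [good]
    counts the exploration steps still guaranteed. *)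
Variables (p x : R) (d K : nat) (E : {set {set V}}) (good : nat -> {set V}).
Hypotheses (p01 : 0 <= p <= 1) (x01 : 0 <= x <= 1) (dx : (1 - p + p * x) ^+ d <= x).
Hypothesis goodS : forall i, good i.+1 \subset good i.
Hypothesis goodP : forall i v U, v \in good i.+1 -> (#|U| < K)%N -> v \in U ->
  (d <= #|[set w in good i | ([set v; w] \in E) && (w \notin U)]|)%N.

(* Exploring the component of [v]: [D] holds the explored vertices and [Q] the
   active ones; exploring one active vertex multiplies the conditional
   expectation of [x ^+ #|Q|] by at most [(1 - p + p * x) ^+ d / x <= 1]. *)
Lemma explore_component v m S F0 (D Q : {set V}) :
  Q \subset good m -> [disjoint D & Q] -> (m + #|D|)%N = K ->
  (forall u, u \in D :|: Q -> u \in component F0 v) ->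
  (forall a b, a \notin D -> b \notin D -> [set a; b] \in E -> [set a; b] \in S) ->
  1 - x ^+ #|Q| <= EE p S (fun F => (K <= #|component (F0 :|: F) v|)%:R).
Proof.
have /andP[x0 x1] := x01.
elim: m S F0 D Q => [|m IH] S F0 D Q Qg DQ mK UC US.
all: have DQc : (#|D :|: Q| <= #|component F0 v|)%N by apply: subset_leq_card; apply/subsetP.
all: have big : (K <= #|D :|: Q|)%N ->
    1 - x ^+ #|Q| <= EE p S (fun F => (K <= #|component (F0 :|: F) v|)%:R).
  1,3: move=> KDQ; rewrite (eq_EE _ (g := fun=> 1)) ?EE_cst ?gerBl ?exprn_ge0//.
  1,2: move=> F _; rewrite (leq_trans KDQ)// (leq_trans DQc)//.
  1,2: by apply: subset_leq_card; apply: component_sub; apply: subsetUl.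
  by apply: big; rewrite -mK add0n subset_leq_card// subsetUl.
have [/big//|UK] := leqP K #|D :|: Q|.
have [->|/set0Pn[u uQ]] := eqVneq Q set0.
  by rewrite cards0 expr0 subrr EE_ge0// => F _; case: leqP.
have uD : u \notin D by rewrite (disjointFl DQ).
have uU : u \in D :|: Q by rewrite inE uQ orbT.
have := goodP (subsetP Qg u uQ) UK uU; set N0 := [set w in _ | _].
move=> /exists_subset_card[N /subsetP NN0 Nd].
have NU w : w \in N -> [/\ w \in good m, [set u; w] \in E & w \notin D :|: Q].
  by move=> /NN0; rewrite inE => /and3P[].
have uN : u \notin N by apply/negP => /NU[_ _]; rewrite uU.
have AS : star u N \subset S.
  apply/subsetP => e /imsetP[w wN ->]; have [_ uwE wU] := NU w wN; apply: US => //.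
  by apply: contra wU => wD; rewrite inE wD.
rewrite (EE_split _ _ AS).
(* One step: [u] leaves the active set, hence [#|Q|.-1], and each edge present in its star activates
   one new vertex. *)
apply: (@le_trans _ _ (EE p (star u N) (fun F1 => 1 - x ^+ #|Q|.-1 * x ^+ #|F1 :&: star u N|))).
  rewrite (eq_EE _ (g := fun F1 => 1 + (- x ^+ #|Q|.-1) * x ^+ #|F1 :&: star u N|)); last first.
    by move=> F1 _; rewrite mulNr.
  rewrite EE_D EE_cst EE_Z EE_pow// card_star// Nd mulNr lerD2l lerN2.
  have -> : x ^+ #|Q| = x ^+ #|Q|.-1 * x by rewrite -exprSr (cardsD1 u Q) uQ.
  by rewrite ler_wpM2l// exprn_ge0.
apply: EE_le => // F1 F1A; rewrite (setIidPl F1A) -exprD.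
pose W := [set w in N | [set u; w] \in F1].
have WF : F1 = star u W.
  apply/setP => e; apply/idP/imsetP => [eF|[w]]; last by rewrite inE => /andP[_ h] ->.
  have /imsetP[w wN ew] := subsetP F1A e eF.
  by exists w => //; rewrite inE wN -ew.
have uW : u \notin W by rewrite inE (negbTE uN).
have cW : #|F1| = #|W| by rewrite WF card_star.
have QW : [disjoint Q & W].
  rewrite disjoint_sym disjoints_subset; apply/subsetP => w; rewrite inE => /andP[/NU[_ _ wU] _].
  by rewrite inE; apply: contra wU => h; rewrite inE h orbT.
have QE : #|(Q :\ u) :|: W| = (#|Q|.-1 + #|F1|)%N.
  rewrite cardsU (_ : (Q :\ u) :&: W = set0) ?cards0 ?subn0 ?cW; last first.
    by apply: disjoint_setI0; apply: disjointWl QW; apply: subD1set.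
  by rewrite (cardsD1 u Q) uQ.
rewrite -QE; have := IH (S :\: star u N) (F0 :|: F1) (u |: D) ((Q :\ u) :|: W).
under [X in _ -> _ -> _ -> _ -> _ -> _ <= X]eq_EE do rewrite -setUA.
apply.
- apply/subsetP => w; rewrite !inE => /orP[/andP[_ wQ]|/andP[/NU[]//]].
  by apply: (subsetP (goodS m)); apply: (subsetP Qg).
- rewrite disjoints_subset; apply/subsetP => w; rewrite !inE => /orP[/eqP->|wD].
    by rewrite eqxx (negbTE uN).
  rewrite (disjointFr DQ wD) andbF /=; apply/negP => /andP[/NU[_ _]].
  by rewrite inE wD.
- by rewrite cardsU1 uD addnA addn1.
- have sub y : y \in component F0 v -> connect (adj (F0 :|: F1)) v y.
    by move=> /(subsetP (component_sub v (subsetUl F0 F1))); rewrite inE.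
  move=> w; rewrite !inE => /orP[/orP[/eqP->|wD]|/orP[/andP[_ wQ]|/andP[wN uwF]]].
  + by apply/sub/UC.
  + by apply/sub/UC; rewrite inE wD.
  + by apply/sub/UC; rewrite inE wQ orbT.
  + apply: connect_trans (sub u (UC u uU)) _.
    by apply: connect1; rewrite /adj /= inE uwF orbT.
- move=> a b; rewrite !inE !negb_or => /andP[au aD] /andP[bu bD] abE.
  rewrite US// andbT; apply/negP => /imsetP[w _ /setP/(_ u)].
  by rewrite !inE eqxx eq_sym (negbTE au) eq_sym (negbTE bu).
Qed.

(** The bound is free of [K]; only the level of [good] required of [v] depends on it. *)
Lemma component_large v : v \in good K ->
  1 - x <= EE p E (fun F => (K <= #|component F v|)%:R).
Proof.
move=> vg; have := @explore_component v K E set0 set0 [set v].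
rewrite cards1 expr1 => h; apply: le_trans (h _ _ _ _ _) _ => //.
- by rewrite sub1set.
- by rewrite disjoints_subset sub0set.
- by rewrite cards0 addn0.
- by move=> u; rewrite set0U inE => /eqP->; rewrite inE connect0.
- by apply: EE_le => // F _; rewrite set0U.
Qed.

End Exploration.

Lemma leq_card_bigcup (I T : finType) (D : {pred I}) (A : I -> {set T}) :
  #|\bigcup_(i in D) A i| <= \sum_(i in D) #|A i|.
Proof.
elim/big_ind2: _ => [|m B n C hB hC|//]; first by rewrite cards0.
by rewrite cardsU; apply: leq_trans (leq_subr _ _) (leq_add hB hC).
Qed.

Section Pieces.
Variables (V : finType) (F : {set {set V}}) (K : nat).
Implicit Types (A B C Q S : {set V}) (P : {set {set V}}) (u v w : V).
Hypothesis K_gt0 : 0 < K.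

Definition nb u : {set V} := [set w | [set u; w] \in F].

Lemma erel_sym A : symmetric (erel F A).
Proof. by move=> x y; rewrite /erel /= setUC andbCA. Qed.

Definition comp_in A v : {set V} := [set u | connect (erel F A) v u].

Lemma connect_in A x y : x \in A -> connect (erel F A) x y -> y \in A.
Proof.
move=> + /connectP[s]; elim: s x => [|z s IH] x xA /=; first by move=> _ ->.
by move=> /andP[/and3P[_ zA _] pz] yl; apply: IH pz yl.
Qed.

Lemma conn_comp_in A v : v \in A -> conn F (comp_in A v).
Proof.
move=> vA; apply/connP; split; first by apply/set0Pn; exists v; rewrite inE connect0.
suff key x y : connect (erel F A) v x -> connect (erel F A) x y ->
    connect (erel F (comp_in A v)) x y.
  move=> x y; rewrite !inE => vx vy; apply: key => //; apply: connect_trans vy.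
  by rewrite (sym_connect_sym (erel_sym A)).
move=> vx /connectP[s]; elim: s x vx => [|z s IH] x vx /=; first by move=> _ ->.
move=> /andP[xz pz] yl; have vz := connect_trans vx (connect1 xz).
apply: connect_trans (IH z vz pz yl); apply: connect1.
by case/and3P: xz => _ _ h; rewrite /erel /= !inE vx vz h.
Qed.

Lemma conn_touch_rest S Q : conn F S -> Q \subset S -> Q != set0 -> S :\: Q != set0 ->
  touch F Q (S :\: Q).
Proof.
move=> /connP[_ cS] /subsetP QS /set0Pn[x xQ] /set0Pn[y yR].
have yS : y \in S by move: yR; rewrite inE => /andP[].
have yQ : y \notin Q by move: yR; rewrite inE => /andP[].
have /connectP[s] := cS x y (QS x xQ) yS.
elim: s x xQ => [|z s IH] x xQ /=; first by move=> _ yx; rewrite yx xQ in yQ.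
move=> /andP[/and3P[xS zS xz] pz] yl.
case: (boolP (z \in Q)) => zQ; first exact: IH pz yl.
by apply/touchP; exists x, z; rewrite inE zQ zS.
Qed.

(** The complement is kept connected so that cutting can continue there. *)
Definition cut_ok S Q : bool :=
  [&& Q \subset S, conn F Q, K <= #|Q| & (S :\: Q == set0) || conn F (S :\: Q)].

(* A minimal connected part [Q] of size at least [K] with connected complement
   falls into components of size less than [K] once [v] is removed. *)
Lemma small_branches S Q v : cut_ok S Q -> (forall Q', cut_ok S Q' -> #|Q| <= #|Q'|) ->
  v \in Q -> (S :\: Q = set0 \/ exists2 z, z \in S :\: Q & [set v; z] \in F) ->
  #|Q| <= 1 + K * #|nb v|.
Proof.
move=> /and4P[QS cQ KQ RQ] Qmin vQ vR.
have [_ hQ] := connP _ _ cQ.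
pose C w := comp_in (Q :\ v) w.
have CQ w : w \in Q :\ v -> C w \subset Q :\ v.
  by move=> wQ; apply/subsetP => y; rewrite [y \in _]inE; apply: connect_in.
have Csmall w : w \in Q :\ v -> #|C w| < K.
  move=> wQ; rewrite ltnNge; apply/negP => KC.
  have CS : C w \subset S by apply: subset_trans QS; apply: subset_trans (CQ w wQ) (subD1set _ _).
  have vC : v \notin C w by apply/negP => /(subsetP (CQ w wQ)); rewrite !inE eqxx.
  have lt : #|C w| < #|Q| by rewrite (cardsD1 v Q) vQ add1n ltnS subset_leq_card// CQ.
  suff : cut_ok S (C w) by move=> /Qmin; rewrite leqNgt lt.
  apply/and4P; split=> //; first exact: conn_comp_in.
  apply/orP; right; apply/connP; split; first by apply/set0Pn; exists v; rewrite inE vC (subsetP QS).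
  (* Outside the branch everything reaches [v]: a path in [Q] towards [v] cannot enter the branch
     before [v], and the rest of [S] uses the edge provided by [vR]. *)
  suff toV y : y \in S :\: C w -> connect (erel F (S :\: C w)) y v.
    move=> x y xS yS; apply: connect_trans (toV x xS) _.
    by rewrite (sym_connect_sym (erel_sym _)) toV.
  rewrite inE => /andP[yC yS]; case: (boolP (y \in Q)) => yQ.
    have /connectP[s] := hQ y v yQ vQ.
    elim: s y yC yQ {yS} => [|z s IH] y yC yQ /=; first by move=> _ <-.
    move=> /andP[/and3P[_ zQ yz] pz] vl.
    have [->|yv] := eqVneq y v; first exact: connect0.
    have zC : z \notin C w.
      apply: contra yC; rewrite !inE => h; apply: (connect_trans h (connect1 _)).
      have : z \in Q :\ v by apply: connect_in wQ h.
      by rewrite /erel /= setUC yz !inE yv yQ => ->.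
    apply: connect_trans (IH z zC zQ pz vl); apply: connect1.
    by rewrite /erel /= !in_setD yC zC yz !(subsetP QS).
  case: vR => [R0|[z zR vz]]; first by have := in_set0 y; rewrite -R0 inE yQ yS.
  have R0 : S :\: Q != set0 by apply/set0Pn; exists z.
  rewrite (negbTE R0) /= in RQ; have [_ hR] := connP _ _ RQ.
  have RS : S :\: Q \subset S :\: C w.
    by apply: setDS; apply: subset_trans (CQ w wQ) (subD1set _ _).
  have yR : y \in S :\: Q by rewrite inE yQ.
  apply: connect_trans (erel_sub RS (hR y z yR zR)) (connect1 _).
  by rewrite /erel /= setUC vz (subsetP RS z zR) inE vC (subsetP QS).
have cov : Q :\ v \subset \bigcup_(w in nb v :&: (Q :\ v)) C w.
  apply/subsetP => y yQ; have := yQ; rewrite !inE => /andP[yv yQ'].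
  have /connectP[s] := hQ y v yQ' vQ.
  elim: s y yQ yv yQ' => [|z s IH] y yQ yv yQ' /=; first by move=> _ vy; rewrite vy eqxx in yv.
  move=> /andP[/and3P[_ zQ yz] pz] vl.
  have [zv|zv] := eqVneq z v.
    by apply/bigcupP; exists y; rewrite inE ?connect0// yQ inE -zv setUC yz.
  have zQv : z \in Q :\ v by rewrite !inE zv.
  have /bigcupP[w wn zC] := IH z zQv zv zQ pz vl.
  apply/bigcupP; exists w => //; move: zC; rewrite !inE => h.
  by apply: (connect_trans h (connect1 _)); rewrite /erel /= setUC yz yQ zQv.
rewrite (cardsD1 v Q) vQ leq_add2l.
apply: leq_trans (subset_leq_card cov) _.
apply: (@leq_trans (\sum_(w in nb v :&: (Q :\ v)) K)).
  apply: leq_trans (leq_card_bigcup _ _) _.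
  by apply: leq_sum => w; rewrite inE => /andP[_ /Csmall/ltnW].
by rewrite sum_nat_const mulnC leq_mul2l subset_leq_card ?orbT// subsetIl.
Qed.

(** A piece may be large, but only in proportion to the degree of one of its own vertices. As the
    pieces are disjoint, degree moments then control the oversized ones. *)
Definition is_piece A : bool := (K <= #|A|) && [exists v in A, #|A| <= K * (2 + #|nb v|)].

(** Minimal cuts are split off while the rest has size at least [K]; a smaller rest stays with the
    last cut and adds fewer than [K] vertices. *)
Lemma cut_connected S : conn F S -> K <= #|S| ->
  exists P, [/\ packing F P, cover P = S & forall A, A \in P -> is_piece A].
Proof.
have [n] := ubnP #|S|; elim: n S => // n IH S Sn cS KS.
have okS : cut_ok S S by rewrite /cut_ok subxx cS KS setDv eqxx.
case: (arg_minnP (fun Q : {set V} => #|Q|) okS) => Q okQ Qmin.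
have /and4P[QS cQ KQ RQ] := okQ.
have Q0 := conn_neq0 cQ.
have single A : conn F A -> is_piece A ->
    exists P, [/\ packing F P, cover P = A & forall A, A \in P -> is_piece A].
  move=> cA pA; exists [set A]; split; last by move=> B; rewrite inE => /eqP->.
    by rewrite /packing trivIset1; apply/forall_inP => B; rewrite inE => /eqP->.
  by rewrite /cover big_set1.
have [R0|R0] := eqVneq (S :\: Q) set0.
  have QE : Q = S by apply/eqP; rewrite eqEsubset QS -setD_eq0 R0 eqxx.
  apply: single => //; rewrite /is_piece KS; move: Q0 => /set0Pn[v vQ].
  apply/existsP; exists v; rewrite -QE vQ.
  have := small_branches okQ Qmin vQ (or_introl R0).
  by move: K_gt0; clear; nia.
rewrite (negbTE R0) /= in RQ.
have /touchP[v [z [vQ zR vz]]] := conn_touch_rest cS QS Q0 R0.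
have bQ := small_branches okQ Qmin vQ (or_intror (ex_intro2 _ _ z zR vz)).
have SE : #|S| = #|Q| + #|S :\: Q| by rewrite -(cardsID Q S) (setIidPr QS).
have [KR|RK] := leqP K #|S :\: Q|; last first.
  apply: single => //; rewrite /is_piece KS.
  by apply/existsP; exists v; rewrite (subsetP QS)//= SE; move: RK bQ; clear; nia.
have [|P [pP covP pieceP]] := IH (S :\: Q) _ RQ KR.
  by move: SE KQ K_gt0 Sn; clear; lia.
have QP A : A \in P -> [disjoint Q & A].
  move=> AP; rewrite disjoint_sym disjoints_subset.
  apply: (@subset_trans _ _ (S :\: Q)); first by rewrite -covP; apply: bigcup_sup.
  by rewrite setDE subsetIr.
exists (Q |: P); split.
- case/andP: pP => tP /forall_inP cP; apply/andP; split.
    apply/trivIsetP => A B; rewrite !inE => /orP[/eqP->|AP] /orP[/eqP->|BP] AB.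
    + by rewrite eqxx in AB.
    + exact: QP.
    + by rewrite disjoint_sym QP.
    + by move/trivIsetP: tP; apply.
  by apply/forall_inP => A; rewrite inE in_set1 => /orP[/eqP->|/cP].
- by rewrite /cover bigcup_setU big_set1 -/(cover P) covP -{1}(setIidPr QS) setID.
- move=> A; rewrite inE in_set1 => /orP[/eqP->|/pieceP//].
  by rewrite /is_piece KQ; apply/existsP; exists v; rewrite vQ /=; move: bQ K_gt0; clear; nia.
Qed.

Lemma conn_component v : conn F (component F v).
Proof.
have -> : component F v = comp_in setT v.
  by apply/setP => u; rewrite !inE; apply: eq_connect => x y; rewrite /erel /= !inE.
by apply: conn_comp_in; rewrite inE.
Qed.

Lemma component_disjoint u v : component F u != component F v -> [disjoint component F u & component F v].
Proof.
apply: contraR => /pred0Pn[w /= /andP[]]; rewrite !inE => uw vw; apply/eqP/setP => z.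
rewrite !inE; have cs := sym_connect_sym (@adj_sym V F).
have uv : connect (adj F) u v by apply: (connect_trans uw); rewrite cs.
exact: (same_connect cs uv).
Qed.

Lemma exists_pieces : exists P, [/\ packing F P,
  cover P = [set v | K <= #|component F v|] & forall A, A \in P -> is_piece A].
Proof.
pose ok C P := [&& packing F P, cover P == C & [forall A in P, is_piece A]].
(* Chosen as a function of the component, so that all its vertices agree on the pieces. *)
pose pc C := odflt set0 [pick P | ok C P].
set X := [set v | _].
have pcP v : v \in X -> ok (component F v) (pc (component F v)).
  rewrite inE => vX; rewrite /pc; case: pickP => //= n.
  have [P [pP cP qP]] := cut_connected (conn_component v) vX.
  by have := n P; rewrite /ok pP cP eqxx /= => /negbT/forall_inP; case; exact: qP.
pose P := \bigcup_(v in X) pc (component F v).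
exists P; split.
- apply/andP; split.
    apply/trivIsetP => A B /bigcupP[u uX Au] /bigcupP[v vX Bv] AB.
    have /and3P[/andP[tu _] /eqP cu _] := pcP u uX.
    have /and3P[/andP[tv _] /eqP cv _] := pcP v vX.
    have [E|N] := eqVneq (component F u) (component F v).
      by move/trivIsetP: tu; apply => //; rewrite E.
    apply: (disjointWl _ (disjointWr _ (component_disjoint N))).
      by rewrite -cu; apply: bigcup_sup.
    by rewrite -cv; apply: bigcup_sup.
  apply/forall_inP => A /bigcupP[u uX Au].
  by have /and3P[/andP[_ /forall_inP/(_ A Au)]] := pcP u uX.
- apply/setP => w; apply/bigcupP/idP => [[A /bigcupP[u uX Au] wA]|wX].
    have /and3P[_ /eqP cu _] := pcP u uX.
    have : w \in component F u by rewrite -cu; apply/bigcupP; exists A.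
    rewrite inE => uw; move: uX; rewrite !inE.
    suff -> : component F u = component F w by [].
    by apply/setP => z; rewrite !inE; apply: same_connect => //; apply: sym_connect_sym (@adj_sym V F).
  have /and3P[_ /eqP cw _] := pcP w wX.
  have : w \in component F w by rewrite inE connect0.
  by rewrite -cw => /bigcupP[A Aw wA]; exists A => //; apply/bigcupP; exists w.
- move=> A /bigcupP[u uX Au].
  by have /and3P[_ _ /forall_inP/(_ A Au)] := pcP u uX.
Qed.

End Pieces.

(** * Many vertices with many neighbours of large degree *)

Section Weights.
Local Open Scope ring_scope.
Variables (R : realFieldType) (T : finType).
Implicit Types (p : R) (S F : {set T}).

Lemma wt_card p S F : F \subset S -> wt p S F = p ^+ #|F| * (1 - p) ^+ (#|S| - #|F|).
Proof.
move=> FS; rewrite /wt (bigID (fun e => e \in F)) /=; congr (_ * _).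
  rewrite (eq_bigl (fun e => e \in F)); last by move=> e; rewrite andb_idl//; apply: (subsetP FS).
  by rewrite (eq_bigr (fun=> p)) ?prodr_const// => e ->.
rewrite (eq_bigl (fun e => e \in S :\: F)); last by move=> e; rewrite inE andbC.
rewrite (eq_bigr (fun=> 1 - p)); last by move=> e; rewrite inE => /andP[/negbTE->].
by rewrite prodr_const cardsD (setIidPr FS).
Qed.

Lemma EE_mem p S (G : {set {set T}}) : G \subset powerset S ->
  EE p S (fun F => (F \in G)%:R) = \sum_(F in G) wt p S F.
Proof.
move=> GS; rewrite /EE [RHS]big_mkcond [LHS]big_mkcond; apply: eq_bigr => F _.
case: (boolP (F \in G)) => FG; first by rewrite (subsetP GS)// mulr1.
by rewrite mulr0 if_same.
Qed.

End Weights.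

Section Hubs.
Local Open Scope ring_scope.
Variables (R : realFieldType) (V : finType) (p : R) (d : nat).
Variables (B : {set V}) (N : V -> {set V}).
Implicit Types (F S : {set {set V}}) (A C : {set V}) (a b : V).
Hypothesis p01 : 0 <= p <= 1.

Definition stars A : {set {set V}} := \bigcup_(a in A) star a (N a).

(* The chance that exactly two of the [d] exposed edges are present and that
   they join one of the pairs of hubs not yet joined, of which there are at
   least ['C(d, 2) - 16 * d] (a truncated difference, equal to 0 if [d <= 33]). *)
Definition hub_rate : R := p ^+ 2 * (1 - p) ^+ (d - 2) * ('C(d, 2) - 16 * d)%:R.

Hypothesis rate_le1 : hub_rate <= 1.

Lemma stars_setD1 A a : a \in A -> [disjoint A & B] -> (forall a, a \in A -> N a \subset B) ->
  stars A :\: star a (N a) = stars (A :\ a).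
Proof.
move=> aA AB NB; apply/setP => e; rewrite inE; apply/andP/bigcupP => [[en /bigcupP[b bA eb]]|].
  by exists b => //; rewrite !inE bA andbT; apply: contraNneq en => <-.
move=> [b]; rewrite !inE => /andP[ba bA] eb; split; last by apply/bigcupP; exists b.
move: eb => /imsetP[w wb ->]; apply/negP => /imsetP[w' wa /setP/(_ b)].
rewrite !inE eqxx (negbTE ba) /= => /esym/eqP bw.
by have := subsetP (NB a aA) w' wa; rewrite -bw (disjointFr AB bA).
Qed.

(** The pairs in [J] are edges of the minor whose branch sets [P b] have grown around the hubs. With
    [C] a neighbourhood this leaves many pairs to be joined; with [C] all of [B] it caps the number
    of joined pairs. *)
Lemma pairs_bound F (P : V -> {set V}) (J : {set {set V}}) C :
  C \subset B -> (forall b, b \in B -> conn F (P b)) ->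
  (forall b b', b \in B -> b' \in B -> b != b' -> [disjoint P b & P b']) ->
  (forall b b', b \in B -> b' \in B -> b != b' -> [set b; b'] \in J -> touch F (P b) (P b')) ->
  (forall e, e \in J -> #|e| = 2) ->
  sparse F -> (#|[set e in J | e \subset C]| <= 16 * #|C|)%N.
Proof.
move=> CB cP dP tP cJ /forall_inP sF.
have inC b : b \in C -> b \in B by apply: (subsetP CB).
have P0 b : b \in C -> P b != set0 by move=> /inC/cP/conn_neq0.
have Pinj : {in C &, injective P}.
  move=> b b' bC b'C E; apply/eqP; apply: contraT => nb.
  have := dP b b' (inC b bC) (inC b' b'C) nb; rewrite E -setI_eq0 setIid.
  by rewrite (negbTE (P0 b' b'C)).
have pQ : packing F (P @: C).
  apply/andP; split.
    apply/trivIsetP => X Y /imsetP[b bC ->] /imsetP[b' b'C ->] XY.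
    by apply: dP; rewrite ?inC//; apply: contraNneq XY => ->.
  by apply/forall_inP => X /imsetP[b bC ->]; apply: cP; apply: inC.
have := sF _ pQ; rewrite card_in_imset// => h; apply: leq_trans h.
rewrite /adjacencies big_imset//=.
pose M b := [set b' in C | (b' != b) && ([set b; b'] \in J)].
apply: (@leq_trans #|\bigcup_(b in C) star b (M b)|).
  apply: subset_leq_card; apply/subsetP => e; rewrite inE => /andP[eJ eC].
  have /eqP/cards2P[b [b' [bb' ee]]] := cJ e eJ.
  have bC : b \in C by apply: (subsetP eC); rewrite ee set21.
  have b'C : b' \in C by apply: (subsetP eC); rewrite ee set22.
  apply/bigcupP; exists b => //; rewrite ee; apply: imset_f.
  by rewrite inE b'C eq_sym bb' -ee.
apply: leq_trans (_ : (\sum_(b in C) #|star b (M b)| <= _)%N).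
  elim/big_ind2: _ => [|m X n Y hX hY|//]; first by rewrite cards0.
  by rewrite cardsU; apply: leq_trans (leq_subr _ _) (leq_add hX hY).
apply: leq_sum => b bC; rewrite card_star; last by rewrite inE eqxx andbF.
rewrite -(card_in_imset (f := P)); last first.
  by move=> x y; rewrite !inE => /andP[xC _] /andP[yC _]; apply: Pinj.
apply: subset_leq_card; apply/subsetP => X /imsetP[b']; rewrite inE => /and3P[b'C bb' h] ->.
rewrite inE imset_f//=; apply/andP; split; last by apply: tP; rewrite ?inC// eq_sym.
by apply: contraNneq bb' => /Pinj ->.
Qed.

(* Each vertex [a] of [A] exposes its [d] edges to hubs; as long as the exposed
   graph is sparse, most pairs of its hubs are not yet joined, so that with
   probability at least [hub_rate] a new pair is joined through [a]. *)
Lemma hub_exposure A F0 (P : V -> {set V}) (J : {set {set V}}) :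
  [disjoint A & B] -> (forall a, a \in A -> N a \subset B /\ #|N a| = d) ->
  (forall b, b \in B -> conn F0 (P b) /\ b \in P b) ->
  (forall b a, b \in B -> a \in A -> a \notin P b) ->
  (forall b b', b \in B -> b' \in B -> b != b' -> [disjoint P b & P b']) ->
  (forall b b', b \in B -> b' \in B -> b != b' -> [set b; b'] \in J -> touch F0 (P b) (P b')) ->
  (forall e, e \in J -> #|e| = 2 /\ e \subset B) ->
  2 ^+ #|J| * EE p (stars A) (fun F => (sparse (F0 :|: F))%:R) <=
    (1 - hub_rate / 2) ^+ #|A| * 2 ^+ (16 * #|B|).
Proof.
have /andP[p0 p1] := p01.
have q0 : 0 <= 1 - hub_rate / 2 by move: hub_rate rate_le1 => c; lra.
elim/set_peel_ind: A F0 P J => [|A a aA IH] F0 P J AB hN cP aP dP tP cJ.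
  rewrite /stars big_set0 EE_set0 setU0 cards0 expr0 mul1r.
  case: (boolP (sparse F0)) => sF; last by rewrite mulr0 exprn_ge0.
  rewrite mulr1 ler_eXn2l ?ltr1n//.
  apply: leq_trans (pairs_bound (subxx B) (fun b bB => (cP b bB).1) dP tP _ sF).
    by rewrite subset_leq_card//; apply/subsetP => e eJ; rewrite inE eJ (cJ e eJ).2.
  by move=> e /cJ[].
have [NB cN] := hN a aA.
have NBall a' : a' \in A -> N a' \subset B by move=> /hN[].
have aB : a \notin B by rewrite (disjointFr AB aA).
have aN : a \notin N a by apply: contra aB; apply: subsetP.
have starsS : star a (N a) \subset stars A by apply: (bigcup_sup a).
rewrite (EE_split _ _ starsS) stars_setD1//.
have AB' : [disjoint A :\ a & B] by apply: disjointWl AB; apply: subD1set.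
have hN' a' : a' \in A :\ a -> N a' \subset B /\ #|N a'| = d by rewrite inE => /andP[_ /hN].
(* The factor [2 ^+ #|J|] acts as a potential: a new pair halves the bound [val] on the remaining
   expectation, so exposing [a] multiplies it by [1 - hub_rate / 2] on average. *)
pose val := (1 - hub_rate / 2) ^+ #|A :\ a| * 2 ^+ (16 * #|B|) / 2 ^+ #|J| : R.
have val0 : 0 <= val by rewrite /val divr_ge0 ?mulr_ge0 ?exprn_ge0.
case: (boolP (sparse F0)) => sF; last first.
  rewrite (eq_EE _ (g := fun=> 0)) ?EE_cst ?mulr0 ?mulr_ge0 ?exprn_ge0// => F1 _.
  rewrite (eq_EE _ (g := fun=> 0)) ?EE_cst// => F2 _.
  rewrite (_ : sparse _ = false)//; apply: contraNF sF; apply: sparse_sub.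
  exact: subsetUl.
pose good := [set C : {set V} | C \subset N a & #|C| == 2] :\: J.
have good_card : ('C(d, 2) - 16 * d <= #|good|)%N.
  rewrite cardsD cards_draws cN leq_sub2l// -cN.
  apply: leq_trans (pairs_bound NB (fun b bB => (cP b bB).1) dP tP _ sF); last by move=> e /cJ[].
  by rewrite subset_leq_card//; apply/subsetP => e; rewrite !inE => /andP[/andP[-> _] ->].
pose G := [set star a C | C in good].
have starN C : C \subset N a -> star a C \subset star a (N a) by move=> CN; apply: imsetS.
have star_inj : {in good &, injective (star a)}.
  have sub C C' : C \subset N a -> star a C = star a C' -> C \subset C'.
    move=> CN E; apply/subsetP => w wC.
    have : [set a; w] \in star a C' by rewrite -E; apply: imset_f.
    move=> /imsetP[w' w'C' /set2_inj->] //.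
    by apply/eqP => wa; case/negP: aN; rewrite -{1}wa (subsetP CN).
  move=> C C'; rewrite !inE => /and3P[_ h _] /and3P[_ h' _] E.
  by apply/eqP; rewrite eqEsubset (sub C C' h E) (sub C' C h' (esym E)).
have GS : G \subset powerset (star a (N a)).
  by apply/subsetP => F /imsetP[C + ->]; rewrite !inE => /and3P[_ /starN].
have massG : hub_rate <= EE p (star a (N a)) (fun F => (F \in G)%:R).
  rewrite EE_mem// big_imset//=.
  rewrite (eq_bigr (fun=> p ^+ 2 * (1 - p) ^+ (d - 2))).
    rewrite sumr_const -mulr_natr /hub_rate ler_wpM2l ?ler_nat//.
    by rewrite mulr_ge0 ?exprn_ge0// subr_ge0.
  move=> C; rewrite !inE => /and3P[_ CN /eqP c2]; rewrite wt_card ?starN//.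
  rewrite !card_star ?cN ?c2//; by apply: contra aN; apply: (subsetP CN).
have step F1 : F1 \subset star a (N a) ->
  EE p (stars (A :\ a)) (fun F2 => (sparse (F0 :|: (F1 :|: F2)))%:R) <=
  val - val / 2 * (F1 \in G)%:R.
  move=> F1S; under eq_EE do rewrite setUA.
  have tsub X Y : touch F0 X Y -> touch (F0 :|: F1) X Y.
    by move=> /touchP[x [y [xX yY xy]]]; apply/touchP; exists x, y; rewrite inE xy.
  have csub X : conn F0 X -> conn (F0 :|: F1) X.
    move=> /connP[X0 cX]; apply/connP; split=> // x y xX yX.
    apply: connect_sub (cX x y xX yX) => u w /and3P[uX wX uw]; apply: connect1.
    by rewrite /erel /= uX wX inE uw.
  case: (boolP (F1 \in G)) => F1G; last first.
    rewrite mulr0 subr0 /val ler_pdivlMr ?exprn_gt0// mulrC; apply: (IH _ P) => //.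
    + by move=> b /cP[/csub ? ?].
    + by move=> b a' bB; rewrite inE => /andP[_ a'A]; apply: aP.
    + by move=> b b' bB b'B bb' h; apply: tsub; apply: tP.
  have /imsetP[C Cgood F1E] := F1G.
  have := Cgood; rewrite !inE => /and3P[CJ CN /cards2P[b [b' [bb' CE]]]].
  have bN : b \in N a by apply: (subsetP CN); rewrite CE set21.
  have b'N : b' \in N a by apply: (subsetP CN); rewrite CE set22.
  have bB := subsetP NB b bN; have b'B := subsetP NB b' b'N.
  have abF : [set a; b] \in F1 by rewrite F1E; apply: imset_f; rewrite CE set21.
  have ab'F : [set a; b'] \in F1 by rewrite F1E; apply: imset_f; rewrite CE set22.
  have dU (X Y : {set V}) : a \notin Y -> [disjoint X & Y] -> [disjoint a |: X & Y].
    by move=> aY XY; rewrite disjoints_subset subUset sub1set inE aY -disjoints_subset.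
  (* [a] is absorbed by the branch set of [b], which then touches that of [b'] through the edge from
     [a] to [b']. *)
  pose P' x := if x == b then a |: P b else P x.
  have PP' x : P x \subset P' x by rewrite /P'; case: eqP => // ->; apply: subsetUr.
  have := IH (F0 :|: F1) P' (C |: J) AB' hN'.
  rewrite cardsU1 CJ exprS => h.
  have {}h : 2 * 2 ^+ #|J| * EE p (stars (A :\ a)) (fun F => (sparse ((F0 :|: F1) :|: F))%:R) <=
    (1 - hub_rate / 2) ^+ #|A :\ a| * 2 ^+ (16 * #|B|).
    apply: h.
    + move=> x xB; split; last by apply: (subsetP (PP' x)); apply: (cP x xB).2.
      rewrite /P'; case: eqP => [_|_]; last by apply: csub; apply: (cP x xB).1.
      apply: conn_setU; last 1 first.
      * by apply/touchP; exists a, b; rewrite !inE eqxx (cP b bB).2 abF orbT.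
      * by apply/connP; split=> [|x' y']; [apply/set0Pn; exists a; rewrite inE|rewrite !inE => /eqP-> /eqP->].
      * by apply: csub; apply: (cP b bB).1.
    + move=> x a' xB; rewrite inE in_set1 => /andP[a'a a'A].
      rewrite /P'; case: eqP => [_|_]; last by apply: aP.
      by rewrite !inE negb_or a'a aP.
    + move=> x y xB yB xy; rewrite /P'.
      case: (eqVneq x b) => [xb|xb]; case: (eqVneq y b) => [yb|yb].
      * by rewrite xb yb eqxx in xy.
      * by apply: dU; [apply: aP|apply: dP => //; rewrite eq_sym].
      * by rewrite disjoint_sym; apply: dU; [apply: aP|apply: dP => //; rewrite eq_sym].
      * exact: dP.
    + move=> x y xB yB xy; rewrite inE in_set1 => /orP[/eqP E|h]; last first.
        by apply: touch_sub (tsub _ _ (tP x y xB yB xy h)).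
      have : touch (F0 :|: F1) (P' b) (P' b').
        apply/touchP; exists a, b'; rewrite inE ab'F orbT /P' eqxx !inE eqxx.
        by rewrite eq_sym (negbTE bb') (cP b' b'B).2.
      have : x \in C by rewrite -E set21.
      have : y \in C by rewrite -E set22.
      rewrite CE !inE => /orP[]/eqP yE /orP[]/eqP xE; rewrite xE yE ?eqxx // in xy *.
      by rewrite touch_sym.
    + move=> e; rewrite inE in_set1 => /orP[/eqP->|/cJ//]; split.
        by rewrite CE cards2 bb'.
      exact: subset_trans NB.
  have J0 : 0 < 2 ^+ #|J| :> R by rewrite exprn_gt0.
  move: h J0; rewrite mulr1 /val.
  move: (EE _ _ _) ((1 - _) ^+ _) (2 ^+ (16 * _)%N) (2 ^+ #|J|) => X Y Z j h j0.
  have -> : Y * Z / j - Y * Z / j / 2 = Y * Z / (2 * j) by field; rewrite gt_eqF.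
  by rewrite ler_pdivlMr ?mulr_gt0// mulrC.
apply: (@le_trans _ _ (2 ^+ #|J| * (val - val / 2 * hub_rate))).
  rewrite ler_wpM2l ?exprn_ge0//.
  apply: le_trans (EE_le p01 step) _.
  rewrite (eq_EE _ (g := fun F => val + (- (val / 2)) * (F \in G)%:R)).
    by rewrite EE_D EE_cst EE_Z mulNr lerD2l lerN2 ler_wpM2l// divr_ge0.
  by move=> F _; rewrite mulNr.
rewrite /val (cardsD1 a A) aA exprS le_eqVlt; apply/orP; left; apply/eqP.
have J0 : 2 ^+ #|J| != 0 :> R by rewrite expf_neq0// pnatr_eq0.
by move: (hub_rate) ((1 - _) ^+ _) (2 ^+ (16 * _)%N) (2 ^+ #|J|) J0 => c Y Z j j0; field.
Qed.

Lemma hub_bound A : [disjoint A & B] -> (forall a, a \in A -> N a \subset B /\ #|N a| = d) ->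
  EE p (stars A) (fun F => (sparse F)%:R) <= (1 - hub_rate / 2) ^+ #|A| * 2 ^+ (16 * #|B|).
Proof.
move=> AB hN; have := @hub_exposure A set0 (fun b => [set b]) set0 AB hN.
rewrite cards0 mul1r => h; apply: le_trans (h _ _ _ _ _).
- by apply: EE_le => // F _; rewrite set0U.
- move=> b _; rewrite inE eqxx; split=> //; apply/connP; split.
    by apply/set0Pn; exists b; rewrite inE.
  by move=> x y; rewrite !inE => /eqP-> /eqP->; apply: connect0.
- by move=> b a bB aA; rewrite inE; apply: contraTneq bB => <-; rewrite (disjointFr AB aA).
- by move=> b b' _ _ bb'; rewrite disjoints1 inE.
- by move=> b b' _ _ _; rewrite inE.
- by move=> e; rewrite inE.
Qed.

End Hubs.

(** * Bounded degree: large components and sprinkling *)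

Section LargeComponents.
Local Open Scope ring_scope.
Variables (R : realFieldType) (V : finType) (K Delta : nat).
Variable H : {set {set V}}.
Implicit Types (F : {set {set V}}) (u v w x y : V).
Hypothesis H2 : forall e, e \in H -> #|e| = 2.
Hypothesis degH : forall v, (#|nb H v| <= Delta)%N.

Definition large F : {set V} := [set v | (K <= #|component F v|)%N].

Definition edge_pairs (A : {set V}) : {set V * V} :=
  [set q : V * V | [&& q.1 \in A, q.2 \in A & [set q.1; q.2] \in H]].

Lemma card_pairs_from (A : {set V}) :
  (#|[set q : V * V | (q.1 \in A) && ([set q.1; q.2] \in H)]| <= #|A| * Delta)%N.
Proof.
rewrite -sum_nat_const.
have -> : [set q : V * V | (q.1 \in A) && ([set q.1; q.2] \in H)] =
    \bigcup_(u in A) [set (u, w) | w in nb H u].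
  apply/setP => -[u w]; rewrite inE /=; apply/andP/bigcupP => [[uA uw]|[v vA]].
    by exists u => //; apply: imset_f; rewrite inE.
  by move=> /imsetP[z]; rewrite inE => vz [-> ->].
apply: leq_trans (leq_card_bigcup _ _) _; apply: leq_sum => u _.
by apply: leq_trans (leq_imset_card _ _) _.
Qed.

Lemma card_pairs_to (A : {set V}) :
  (#|[set q : V * V | (q.2 \in A) && ([set q.1; q.2] \in H)]| <= #|A| * Delta)%N.
Proof.
apply: leq_trans (card_pairs_from A).
rewrite -(card_imset _ (f := fun q : V * V => (q.2, q.1))); last by move=> [a b] [c d] [-> ->].
apply: subset_leq_card; apply/subsetP => q /imsetP[[u w]]; rewrite inE /= => /andP[wA uw] ->.
by rewrite inE /= wA setUC.
Qed.

Lemma large_sub F F' : F \subset F' -> large F \subset large F'.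
Proof.
move=> FF; apply/subsetP => v; rewrite !inE => h; apply: leq_trans h _.
exact/subset_leq_card/component_sub.
Qed.

Lemma component_eq F u v : u \in component F v -> component F u = component F v.
Proof.
rewrite inE => vu; apply/setP => z; rewrite !inE.
by rewrite -(same_connect (sym_connect_sym (@adj_sym V F)) vu).
Qed.

(** Only components of the two ends change, so newly large vertices come from at most two components
    of size below [K]. *)
Lemma large_setU1 F x y : exists2 D : {set V}, (#|D| <= 2 * K)%N &
  large ([set x; y] |: F) \subset large F :|: D.
Proof.
pose sm z := if (#|component F z| < K)%N then component F z else set0.
have smK z : (#|sm z| <= K)%N by rewrite /sm; case: ltnP => [/ltnW//|]; rewrite cards0.
exists (sm x :|: sm y).
  rewrite mul2n -addnn; apply: leq_trans (leq_add (smK x) (smK y)).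
  by rewrite cardsU leq_subr.
have self z : z \in component F z by rewrite inE connect0.
apply/subsetP => v; rewrite 2!in_setU [v \in large _]inE [v \in large F]inE.
move=> h; case: (leqP K #|component F v|) => //= vK.
have hs z : z \in component F v -> v \in sm z.
  by move=> /component_eq zv; rewrite /sm zv vK self.
case: (boolP (x \in component F v)) => [/hs->//|xv].
case: (boolP (y \in component F v)) => [/hs->|yv]; first by rewrite orbT.
suff sub : component ([set x; y] |: F) v \subset component F v.
  by have := leq_trans h (subset_leq_card sub); rewrite leqNgt vK.
apply/subsetP => z; rewrite [z \in _]inE => /connectP[s].
have := self v; elim: s {1 3 4}v => [|t s IH] u uv /=; first by move=> _ ->.
move=> /andP[ut pt] zl; apply: IH pt zl.
move: ut; rewrite /adj /= in_setU1 => /orP[/eqP E|ut]; last first.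
  by move: uv; rewrite !inE => uv; apply: (connect_trans uv); apply: connect1.
have : u \in [set x; y] by rewrite -E set21.
by rewrite !inE => /orP[]/eqP E'; rewrite -E' uv in xv yv.
Qed.

(** At most [2 * K] vertices become large, each in at most [Delta] edges, and a pair can contain one
    of them in either coordinate. *)
Lemma edge_pairs_lipschitz F e : e \in H ->
  `|#|edge_pairs (large (e |: F))|%:R - #|edge_pairs (large F)|%:R| <=
    (4 * K * Delta)%:R :> R.
Proof.
move=> eH; have /eqP/cards2P[x [y [_ ->]]] := H2 eH.
have [D DK sub] := large_setU1 F x y.
have le1 : (#|edge_pairs (large F)| <= #|edge_pairs (large ([set x; y] |: F))|)%N.
  have /subsetP s := large_sub (subsetUr [set [set x; y]] F).
  apply/subset_leq_card/subsetP => q; rewrite [q \in _]inE => /and3P[h1 h2 h3].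
  by rewrite inE h3 !s.
have le2 : (#|edge_pairs (large ([set x; y] |: F))| <= #|edge_pairs (large F)| + 4 * K * Delta)%N.
  apply: (@leq_trans #|edge_pairs (large F) :|:
     ([set q : V * V | (q.1 \in D) && ([set q.1; q.2] \in H)] :|:
      [set q : V * V | (q.2 \in D) && ([set q.1; q.2] \in H)])|).
    apply/subset_leq_card/subsetP => q; rewrite [q \in _]inE => /and3P[q1 q2 qH].
    case/setUP: (subsetP sub _ q1) => [l1|d1]; last first.
      by apply/setUP; right; apply/setUP; left; rewrite inE d1.
    case/setUP: (subsetP sub _ q2) => [l2|d2]; last first.
      by apply/setUP; right; apply/setUP; right; rewrite inE d2.
    by apply/setUP; left; rewrite inE l1 l2.
  apply: leq_trans (leq_card_setU _ _) _; rewrite leq_add2l.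
  apply: leq_trans (leq_card_setU _ _) _.
  apply: leq_trans (leq_add (card_pairs_from D) (card_pairs_to D)) _.
  by rewrite addnn -mul2n mulnA leq_mul2r -[4%N]/(2 * 2)%N -mulnA leq_mul2l DK !orbT.
rewrite ger0_norm ?subr_ge0 ?ler_nat//.
by rewrite lerBlDr -natrD ler_nat addnC.
Qed.

Variables (p g : R) (good : {set V}).
Hypotheses (p01 : 0 <= p <= 1) (g_gt0 : 0 < g).
Hypothesis goodP : forall v, v \in good -> g <= EE p H (fun F => (v \in large F)%:R).

(** Lying in a large component is an increasing event, so by Harris both ends of an edge are large
    with probability at least [g ^+ 2], however dependent they are. *)
Lemma mean_edge_pairs :
  g ^+ 2 * #|edge_pairs good|%:R <= EE p H (fun F => #|edge_pairs (large F)|%:R).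
Proof.
rewrite (eq_EE _ (g := fun F => \sum_(q : V * V | [set q.1; q.2] \in H)
   (q.1 \in large F)%:R * (q.2 \in large F)%:R)); last first.
  move=> F _; rewrite -sum1_card natr_sum big_mkcond [RHS]big_mkcond; apply: eq_bigr => q _.
  by rewrite inE; case: (_ \in H); case: (_ \in _); case: (_ \in _); rewrite /= ?mulr1 ?mulr0.
rewrite EE_sum -sum1_card natr_sum big_distrr /= big_mkcond [leRHS]big_mkcond.
apply: ler_sum => q _; rewrite inE.
have mono v : forall F1 F2, F1 \subset F2 -> (v \in large F1)%:R <= (v \in large F2)%:R :> R.
  move=> F1 F2 FF; rewrite ler_nat.
  by case: (boolP (v \in large F1)) => //= /(subsetP (large_sub FF)) ->.
case: (_ \in H); rewrite ?andbF// andbT.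
have pos : 0 <= EE p H (fun F => (q.1 \in large F)%:R * (q.2 \in large F)%:R).
  by apply: EE_ge0 => // F _; rewrite mulr_ge0.
case: (boolP (q.1 \in good)) => //= q1; case: (boolP (q.2 \in good)) => //= q2.
rewrite mulr1; apply: le_trans (@EE_harris _ _ p H (fun F => (q.1 \in large F)%:R)
  (fun F => (q.2 \in large F)%:R) p01 (mono _) (mono _)).
by rewrite expr2 ler_pM ?goodP// ltW.
Qed.

Lemma edge_pairs_tail (M : R) : 0 < M -> M <= g ^+ 2 * #|edge_pairs good|%:R ->
  EE p H (fun F => (#|edge_pairs (large F)|%:R < M / 2)%R%:R) <=
    4 * (#|H|%:R * p * (4 * K * Delta)%:R ^+ 2) / M ^+ 2.
Proof.
move=> M0 hM; apply: EE_chebyshev => //.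
  by move=> F e; apply: edge_pairs_lipschitz.
exact: le_trans mean_edge_pairs.
Qed.

(** The exponential moment is what [EE_pow] computes, and it dominates the squared degrees that
    govern the sizes of pieces. It stays bounded as long as [p * Delta] does. *)
Lemma mean_degree_exp :
  EE p H (fun F => \sum_v 2 ^+ #|nb F v|) <= #|V|%:R * (1 + p) ^+ Delta.
Proof.
have /andP[p0 _] := p01.
rewrite EE_sum -[#|V|]/#|xpredT| -sum1_card natr_sum big_distrl; apply: ler_sum => v _ /=.
have vn : v \notin nb H v by rewrite inE; apply/negP => /H2; rewrite setUid cards1.
have sub : star v (nb H v) \subset H.
  by apply/subsetP => e /imsetP[w]; rewrite inE => h ->.
rewrite (eq_EE _ (g := fun F => 2 ^+ #|F :&: star v (nb H v)|)).
  rewrite EE_pow// card_star// [1%:R * _]mul1r (_ : 1 - p + p * 2 = 1 + p); last by ring.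
  by rewrite ler_weXn2l// lerDl.
move=> F FH; congr (_ ^+ _).
have FvH : nb F v \subset nb H v by apply/subsetP => w; rewrite !inE; apply: (subsetP FH).
rewrite -(card_star (u := v) (N := nb F v)); last by apply: contra vn; apply: (subsetP FvH).
congr #|pred_of_set _|; apply/setP => e; rewrite inE; apply/imsetP/andP => [[w]|[eF /imsetP[w wn E]]].
  by rewrite inE => h ->; split=> //; apply: imset_f; rewrite inE; apply: (subsetP FH).
by exists w => //; rewrite inE -E.
Qed.

Lemma degree_exp_tail (L : R) : 0 < L -> (0 < #|V|)%N ->
  EE p H (fun F => (L * #|V|%:R < \sum_v 2 ^+ #|nb F v|)%R%:R) <= (1 + p) ^+ Delta / L.
Proof.
move=> L0 V0; rewrite ler_pdivlMr//.
have V0' : 0 < #|V|%:R :> R by rewrite ltr0n.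
rewrite -(ler_pM2l V0'); apply: le_trans mean_degree_exp.
rewrite mulrC -mulrA mulrC -EE_Z; apply: EE_le => // F _.
case: ltP => h; first by rewrite mulr1 ltW.
by rewrite mulr0; apply: sumr_ge0 => v _; rewrite exprn_ge0.
Qed.

End LargeComponents.

Section Bernoulli.
Local Open Scope ring_scope.

(** A rational substitute for [(1 - z) ^+ k <= exp (- k z)]. *)
Lemma expr_bernoulli (R : realFieldType) (z : R) k : 0 <= z <= 1 ->
  (1 - z) ^+ k * (1 + k%:R * z) <= 1.
Proof.
move=> /andP[z0 z1]; elim: k => [|k IH]; first by rewrite expr0 mul0r addr0 mulr1.
apply: le_trans IH; rewrite exprSr -mulrA ler_wpM2l ?exprn_ge0 ?subr_ge0//.
have k0 : 0 <= k%:R :> R by [].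
by rewrite -natr1; nra.
Qed.

End Bernoulli.

(** * The second round: joining disjoint sets of bounded size *)

Section Sprinkling.
Local Open Scope ring_scope.
Variables (R : realFieldType) (V : finType) (T : nat) (p : R).
Variables (H Q : {set {set V}}).
Implicit Types (F : {set {set V}}) (A B : {set V}).
Hypothesis H2 : forall e, e \in H -> #|e| = 2.
Hypothesis p01 : 0 <= p <= 1.
Hypothesis tQ : trivIset Q.
Hypothesis QT : forall A, A \in Q -> (#|A| <= T)%N.
Hypothesis pT : p * (T ^ 2)%:R <= 1.

Definition touching F : {set {set V} * {set V}} :=
  [set AB | [&& AB.1 \in Q, AB.2 \in Q, AB.2 != AB.1 & touch F AB.1 AB.2]].

Lemma adjacenciesE F : adjacencies F Q = #|touching F|.
Proof.
rewrite /adjacencies -sum1_card.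
rewrite (eq_bigr (fun A => \sum_(B in nbrs F Q A) 1)%N); last by move=> A _; rewrite sum1_card.
rewrite pair_big_dep /=; apply: eq_bigl => -[A B].
by rewrite !inE /=; case: (A \in Q); rewrite //= -andbA.
Qed.

(** Each end of an edge lies in at most one member of [Q], so an edge creates at most one touching
    pair, in two orders. *)
Lemma touching_lipschitz F e : e \in H ->
  `|#|touching (e |: F)|%:R - #|touching F|%:R| <= 2 :> R.
Proof.
move=> eH; have /eqP/cards2P[x [y [_ eE]]] := H2 eH.
have le1 : (#|touching F| <= #|touching (e |: F)|)%N.
  apply/subset_leq_card/subsetP => q; rewrite !inE => /and4P[-> -> -> /touchP[a [b [aA bB ab]]]] /=.
  by apply/touchP; exists a, b; rewrite inE ab orbT.
have le2 : (#|touching (e |: F)| <= #|touching F| + 2)%N.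
  apply: (@leq_trans #|touching F :|: ([set (pblock Q x, pblock Q y)] :|:
     [set (pblock Q y, pblock Q x)])|).
    apply/subset_leq_card/subsetP => -[A B]; rewrite [_ \in _]inE /=.
    move=> /and4P[AQ BQ AB /touchP[a [b [aA bB]]]]; rewrite in_setU1 => /orP[/eqP ab|ab].
      rewrite -(def_pblock tQ AQ aA) -(def_pblock tQ BQ bB) in AB *.
      have : a \in [set x; y] by rewrite -eE -ab set21.
      have : b \in [set x; y] by rewrite -eE -ab set22.
      by rewrite !inE => /orP[]/eqP eb /orP[]/eqP ea; rewrite ?ea ?eb ?eqxx ?orbT // in AB *.
    by rewrite !inE AQ BQ AB /=; apply/orP; left; apply/touchP; exists a, b.
  apply: leq_trans (leq_card_setU _ _) _; rewrite leq_add2l.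
  by apply: leq_trans (leq_card_setU _ _) _; rewrite !cards1.
rewrite ger0_norm ?subr_ge0 ?ler_nat//.
by rewrite lerBlDr -natrD ler_nat addnC.
Qed.

Definition between A B : {set V * V} :=
  [set q | [&& q.1 \in A, q.2 \in B & [set q.1; q.2] \in H]].

(** There are at most [T ^ 2] edges between [A] and [B], so [pT] keeps their expected number below
    1, where the probability of seeing one is still linear in their number. *)
Lemma touch_prob A B : A \in Q -> B \in Q -> B != A ->
  p / 2 * #|between A B|%:R <= EE p H (fun F => (touch F A B)%:R).
Proof.
move=> AQ BQ AB; have /andP[p0 p1] := p01.
have dAB : [disjoint A & B] by move/trivIsetP: tQ; apply; rewrite // eq_sym.
pose S := [set [set q.1; q.2] | q in between A B].
have cS : #|S| = #|between A B|.
  apply: card_in_imset => -[a b] [c d]; rewrite !inE /= => /and3P[aA bB _] /and3P[cA dB _] E.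
  have nAB z : z \in A -> z \in B -> False by move=> /(disjointFr dAB) ->.
  have : a \in [set c; d] by rewrite -E set21.
  have : b \in [set c; d] by rewrite -E set22.
  rewrite !inE => /orP[]/eqP eb /orP[]/eqP ea; subst => //.
  - by case: (nAB c).
  - by case: (nAB c).
  - by case: (nAB d).
have SH : S \subset H by apply/subsetP => e /imsetP[q]; rewrite inE => /and3P[_ _ h] ->.
rewrite (eq_EE _ (g := fun F => 1 + (-1) * 0 ^+ #|F :&: S|)); last first.
  move=> F FH; rewrite expr0n cards_eq0 mulN1r.
  case: (boolP (touch F A B)) => [/touchP[a [b [aA bB ab]]]|nt].
    rewrite (_ : (F :&: S == set0) = false) ?subr0//.
    apply/negbTE/set0Pn; exists [set a; b]; rewrite inE ab; apply/imsetP; exists (a, b) => //.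
    by rewrite inE /= aA bB (subsetP FH).
  rewrite (_ : (F :&: S == set0) = true) ?subrr//.
  apply/eqP/setP => e; rewrite !inE; apply: contraNF nt => /andP[eF /imsetP[[a b]]].
  by rewrite inE /= => /and3P[aA bB _] E; apply/touchP; exists a, b; rewrite -E.
rewrite EE_D EE_cst EE_Z EE_pow// mulr0 addr0 cS mulN1r.
have := expr_bernoulli #|between A B| p01.
have kT : (#|between A B| <= T ^ 2)%N.
  apply: (@leq_trans #|setX A B|).
    by apply/subset_leq_card/subsetP => q; rewrite !inE => /and3P[-> ->].
  by rewrite cardsX expnS expn1 leq_mul// QT.
have kp : p * #|between A B|%:R <= 1.
  by apply: le_trans pT; rewrite ler_wpM2l// ler_nat.
have k0 : 0 <= #|between A B|%:R :> R by [].
have e0 : 0 <= (1 - p) ^+ #|between A B| by rewrite exprn_ge0// subr_ge0.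
move: (#|between A B|%:R) kp k0 ((1 - p) ^+ _) e0 => k kp k0 X X0 h.
have z0 : 0 <= p * k by rewrite mulr_ge0.
rewrite (mulrC k) in h; rewrite (_ : p / 2 * k = p * k / 2); last by field.
move: (p * k) z0 kp h => z z0 z1 h; nra.
Qed.

Definition crossing_pairs : {set V * V} :=
  [set q | [&& [set q.1; q.2] \in H & [exists A in Q, exists B in Q,
     [&& B != A, q.1 \in A & q.2 \in B]]]].

Lemma mean_touching : p / 2 * #|crossing_pairs|%:R <= EE p H (fun F => #|touching F|%:R).
Proof.
have /andP[p0 p1] := p01.
pose D : {set {set V} * {set V}} := [set AB | [&& AB.1 \in Q, AB.2 \in Q & AB.2 != AB.1]].
rewrite (eq_EE _ (g := fun F => \sum_(AB in D) (touch F AB.1 AB.2)%:R)); last first.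
  move=> F _; rewrite -sum1_card natr_sum big_mkcond [RHS]big_mkcond; apply: eq_bigr => AB _.
  by rewrite !inE; case: (AB.1 \in Q); case: (AB.2 \in Q); case: (AB.2 == AB.1); case: touch.
rewrite EE_sum.
apply: (@le_trans _ _ (\sum_(AB in D) p / 2 * #|between AB.1 AB.2|%:R)); last first.
  by apply: ler_sum => -[A B]; rewrite inE /= => /and3P[AQ BQ AB]; apply: touch_prob.
rewrite -big_distrr /= ler_wpM2l ?divr_ge0// -natr_sum ler_nat.
apply: leq_trans (leq_card_bigcup _ _); apply/subset_leq_card/subsetP => q.
rewrite inE => /andP[qH /exists_inP[A AQ /exists_inP[B BQ /and3P[AB qA qB]]]].
by apply/bigcupP; exists (A, B); rewrite !inE /= ?AQ ?BQ ?AB ?qA ?qB.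
Qed.

Lemma adjacencies_tail (U : R) : 0 < p -> 0 < U -> U <= #|crossing_pairs|%:R ->
  EE p H (fun F => ((adjacencies F Q)%:R < p * U / 4)%R%:R) <= 64 * #|H|%:R / (p * U ^+ 2).
Proof.
move=> p0 U0 hU.
have m0 : 0 < p / 2 * U by rewrite mulr_gt0// divr_gt0.
have hm : p / 2 * U <= EE p H (fun F => #|touching F|%:R).
  by apply: le_trans mean_touching; rewrite ler_wpM2l// divr_ge0// ltW.
have c2 : 0 <= 2 :> R by [].
have h := EE_chebyshev p01 c2 m0 (fun F e eH => touching_lipschitz F eH) hm.
rewrite (_ : 64 * _ / _ = 4 * (#|H|%:R * p * 2 ^+ 2) / (p / 2 * U) ^+ 2); last first.
  by field; rewrite !gt_eqF.
rewrite (_ : p * U / 4 = p / 2 * U / 2); last by field.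
apply: le_trans h; apply: EE_le => // F _.
by rewrite adjacenciesE.
Qed.

End Sprinkling.

(** * Counting edges between pieces of bounded size *)

Section Bounded.
Local Open Scope ring_scope.
Variables (V : finType) (K Delta T : nat) (H : {set {set V}}).
Implicit Types (F P : {set {set V}}).
Hypothesis degH : forall v, (#|nb H v| <= Delta)%N.
Hypothesis K0 : (0 < K)%N.

Lemma sqr_le_expn d : ((2 + d) ^ 2 <= 5 * 2 ^ d)%N.
Proof.
elim: d => [|[|d] IH] //; rewrite (expnS 2 d.+1); move: IH; rewrite -!mulnn.
by move: (2 ^ d.+1)%N => X; nia.
Qed.

Lemma sum_card_trivIset P (g : V -> nat) : trivIset P ->
  (\sum_(A in P) \sum_(v in A) g v <= \sum_v g v)%N.
Proof.
by move=> tP; rewrite -big_trivIset //= [leqRHS](bigID (fun v => v \in cover P)) /= leq_addr.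
Qed.

(** An oversized piece satisfies [T * #|A| <= #|A| ^ 2], and [is_piece] charges [#|A| ^ 2] to the
    degree of a single vertex of [A]. *)
Lemma large_pieces F P : trivIset P -> (forall A, A \in P -> is_piece F K A) ->
  (T * #|cover [set A in P | (T < #|A|)%N]| <= 5 * K ^ 2 * \sum_v 2 ^ #|nb F v|)%N.
Proof.
move=> tP pP; set big := [set A in P | _].
have tb : trivIset big by apply: trivIsetS tP; apply/subsetP => A; rewrite inE => /andP[].
have := leq_card_cover big; rewrite tb => -[_ /eqP->].
apply: (@leq_trans (\sum_(A in P) #|A| ^ 2)).
  rewrite big_distrr /= big_mkcond [leqRHS]big_mkcond; apply: leq_sum => A _.
  rewrite inE; case: (A \in P) => //=; case: ltnP => // TA.
  by rewrite expnS expn1 leq_mul2r (ltnW TA) orbT.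
apply: (@leq_trans (\sum_(A in P) \sum_(v in A) 5 * K ^ 2 * 2 ^ #|nb F v|)).
  apply: leq_sum => A /pP /andP[_ /exists_inP[v vA Av]].
  rewrite (bigD1 v) //=; apply: leq_trans (leq_addr _ _).
  apply: (@leq_trans ((K * (2 + #|nb F v|)) ^ 2)); first by rewrite leq_exp2r.
  have := sqr_le_expn #|nb F v|; rewrite expnMn; nia.
by rewrite [leqRHS]big_distrr /=; apply: sum_card_trivIset.
Qed.

(** A pair inside the large components runs between two pieces of size at most [T], has an end in an
    oversized piece, or stays in one piece of size at most [T]; the last kind has at most [T] pairs
    per vertex. *)
Lemma count_crossing F P : trivIset P -> cover P = large K F ->
  (#|edge_pairs H (large K F)| <= #|crossing_pairs H [set A in P | (#|A| <= T)%N]| +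
     2 * Delta * #|cover [set A in P | (T < #|A|)%N]| + T * #|V|)%N.
Proof.
move=> tP cP; set Q := [set A in P | (#|A| <= T)%N]; set big := [set A in P | _].
have tQ : trivIset Q by apply: trivIsetS tP; apply/subsetP => A; rewrite inE => /andP[].
pose inner := \bigcup_(A in Q) setX A A.
have innerT : (#|inner| <= T * #|V|)%N.
  apply: leq_trans (leq_card_bigcup _ _) _.
  apply: (@leq_trans (\sum_(A in Q) \sum_(v in A) T)).
    apply: leq_sum => A; rewrite inE => /andP[_ AT].
    by rewrite cardsX sum_nat_const leq_mul2l AT orbT.
  by apply: leq_trans (sum_card_trivIset _ tQ) _; rewrite sum_nat_const mulnC.
apply: (@leq_trans #|crossing_pairs H Q :|:
   ([set q : V * V | (q.1 \in cover big) && ([set q.1; q.2] \in H)] :|: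
    [set q : V * V | (q.2 \in cover big) && ([set q.1; q.2] \in H)]) :|: inner|).
  apply/subset_leq_card/subsetP => q; rewrite [q \in _]inE -cP => /and3P[q1 q2 qH].
  have /bigcupP[A AP qA] := q1; have /bigcupP[B BP qB] := q2.
  have [AT|TA] := leqP #|A| T; last first.
    apply/setUP; left; apply/setUP; right; apply/setUP; left; rewrite inE qH andbT.
    by apply/bigcupP; exists A; rewrite ?inE ?AP.
  have [BT|TB] := leqP #|B| T; last first.
    apply/setUP; left; apply/setUP; right; apply/setUP; right; rewrite inE qH andbT.
    by apply/bigcupP; exists B; rewrite ?inE ?BP.
  have AQ : A \in Q by rewrite inE AP.
  have BQ : B \in Q by rewrite inE BP.
  have [BA|AB] := eqVneq B A.
    by apply/setUP; right; apply/bigcupP; exists A; rewrite // inE qA -BA qB.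
  apply/setUP; left; apply/setUP; left; rewrite inE qH /=.
  by apply/exists_inP; exists A => //; apply/exists_inP; exists B; rewrite ?AB ?qA.
apply: leq_trans (leq_card_setU _ _) _; apply: leq_add innerT.
apply: leq_trans (leq_card_setU _ _) _; rewrite leq_add2l.
apply: leq_trans (leq_card_setU _ _) _.
apply: leq_trans (leq_add (card_pairs_from degH _) (card_pairs_to degH _)) _.
by rewrite addnn -mul2n (mulnC _ Delta) mulnA.
Qed.

End Bounded.

Section BoundedCase.
Local Open Scope ring_scope.
Variables (R : realFieldType) (V : finType) (K Delta T : nat) (H : {set {set V}}).
Implicit Types (F P : {set {set V}}).
Hypothesis H2 : forall e, e \in H -> #|e| = 2.
Hypothesis degH : forall v, (#|nb H v| <= Delta)%N.
Hypothesis K0 : (0 < K)%N.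
Hypothesis T0 : (0 < T)%N.
Hypothesis V0 : (0 < #|V|)%N.
(** [M] bounds from below the mean number of edge pairs in large components, [L] is the average of
    [2 ^+] degree that is tolerated, and [U] is the number of crossing pairs left for the second
    round. *)
Variables (p p1 p2 g M L U : R) (good : {set V}).
Hypotheses (p1_01 : 0 <= p1 <= 1) (p2_01 : 0 <= p2 <= 1) (p2_gt0 : 0 < p2).
Hypothesis pE : 1 - p = (1 - p1) * (1 - p2).
Hypothesis g_gt0 : 0 < g.
Hypothesis goodP : forall v, v \in good -> g <= EE p1 H (fun F => (v \in large K F)%:R).
Hypotheses (M0 : 0 < M) (hM : M <= g ^+ 2 * #|edge_pairs H good|%:R) (L0 : 0 < L) (U0 : 0 < U).
Hypothesis hU : U + (2 * Delta)%:R * (5 * K ^ 2)%:R * (L * #|V|%:R) / T%:R + (T * #|V|)%:R <= M / 2.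
Hypothesis pT : p2 * (T ^ 2)%:R <= 1.
Hypothesis dense : 16 * #|V|%:R / K%:R < p2 * U / 4.

(** The pieces remain connected after sprinkling and have size at least [K], so sparsity would allow
    them at most [16 * #|V| / K] adjacencies; by [dense] this is below half of the expected lower
    bound. *)
Lemma sprinkle_large_components F1 : F1 \subset H ->
  M / 2 <= #|edge_pairs H (large K F1)|%:R ->
  \sum_v 2 ^+ #|nb F1 v| <= L * #|V|%:R ->
  EE p2 H (fun F2 => (sparse (F1 :|: F2))%:R) <= 64 * #|H|%:R / (p2 * U ^+ 2).
Proof.
move=> F1H hMl hL.
have [P [pP cP pieceP]] := exists_pieces F1 K0.
have tP : trivIset P by case/andP: pP.
pose Q := [set A in P | (#|A| <= T)%N].
have QP : Q \subset P by apply/subsetP => A; rewrite inE => /andP[].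
have QT A : A \in Q -> (#|A| <= T)%N by rewrite inE => /andP[].
have T0' : 0 < T%:R :> R by rewrite ltr0n.
have hc : U <= #|crossing_pairs H Q|%:R.
  have c1 := count_crossing T degH tP cP; rewrite -/Q in c1.
  have c2 := large_pieces T K0 tP pieceP.
  move: c1 c2; set big := cover _ => c1 c2.
  have c2' : T%:R * #|big|%:R <= (5 * K ^ 2)%:R * (L * #|V|%:R) :> R.
    rewrite -natrM; apply: (@le_trans _ _ (5 * K ^ 2 * \sum_v 2 ^ #|nb F1 v|)%N%:R).
      by rewrite ler_nat.
    rewrite natrM ler_wpM2l//; apply: le_trans hL.
    by rewrite natr_sum; apply: ler_sum => v _; rewrite natrX.
  have c3 : (2 * Delta)%:R * #|big|%:R <= (2 * Delta)%:R * (5 * K ^ 2)%:R * (L * #|V|%:R) / T%:R :> R.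
    rewrite ler_pdivlMr//.
    apply: (@le_trans _ _ ((2 * Delta)%:R * (T%:R * #|big|%:R))).
      by rewrite -mulrA (mulrC #|big|%:R).
    apply: le_trans (ler_wpM2l _ c2') _ => //.
    by rewrite [leLHS]mulrA.
  have c1' : #|edge_pairs H (large K F1)|%:R <=
     #|crossing_pairs H Q|%:R + (2 * Delta)%:R * #|big|%:R + (T * #|V|)%:R :> R.
    by rewrite -natrM -!natrD ler_nat.
  move: hU hMl c1' c3; set a := _ / T%:R; set b := (2 * Delta)%:R * _; lra.
have tail := adjacencies_tail H2 p2_01 (trivIsetS QP tP) QT pT p2_gt0 U0 hc.
apply: le_trans tail; apply: EE_le => // F2 _; rewrite ler_nat.
case: (boolP (sparse _)) => // sF; rewrite (_ : (_ < _)%R = true)//.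
apply: le_lt_trans dense.
have pQ : packing (F1 :|: F2) Q.
  apply: packing_sub QP _; case/andP: pP => _ /forall_inP cA; apply/andP; split=> //.
  apply/forall_inP => A /cA /connP[A0 h]; apply/connP; split=> // x y xA yA.
  apply: connect_sub (h x y xA yA) => u w /and3P[uA wA uw]; apply: connect1.
  by rewrite /erel /= uA wA inE uw.
have /forall_inP/(_ Q pQ) h16 := sF.
have KQ : (K * #|Q| <= #|V|)%N.
  rewrite mulnC -sum_nat_const; apply: (@leq_trans (\sum_(A in Q) \sum_(v in A) 1)).
    by apply: leq_sum => A /(subsetP QP)/pieceP/andP[KA _]; rewrite sum1_card.
  by apply: leq_trans (sum_card_trivIset _ (trivIsetS QP tP)) _; rewrite sum1_card.
have K0' : 0 < K%:R :> R by rewrite ltr0n.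
rewrite ler_pdivlMr// -!natrM ler_nat.
apply: leq_trans (_ : 16 * #|Q| * K <= _)%N; last by rewrite -mulnA (mulnC _ K) leq_mul2l KQ.
rewrite leq_mul2r; apply/orP; right; apply: leq_trans h16.
apply: leq_sum => A AQ; apply/subset_leq_card/subsetP => B; rewrite !inE => /and3P[-> -> h] /=.
by move: h => /touchP[x [y [xA yB xy]]]; apply/touchP; exists x, y; rewrite inE xy orbT.
Qed.

(** A union bound over three failures: too few edge pairs in large components, too large degrees, a
    second round that joins too little. *)
Lemma bounded_degree_bound :
  EE p H (fun F => (sparse F)%:R) <=
    4 * (#|H|%:R * p1 * (4 * K * Delta)%:R ^+ 2) / M ^+ 2 +
    (1 + p1) ^+ Delta / L + 64 * #|H|%:R / (p2 * U ^+ 2).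
Proof.
rewrite (EE_rounds _ _ pE).
have t1 := edge_pairs_tail H2 degH p1_01 g_gt0 goodP M0 hM.
have t2 := degree_exp_tail H2 degH p1_01 L0 V0.
set c := 64 * _ / _.
apply: le_trans (lerD (lerD t1 t2) (lexx c)); rewrite -(EE_cst p1 H c) -!EE_D.
apply: EE_le => // F1 F1H.
have c0 : 0 <= c by rewrite /c divr_ge0 ?mulr_ge0 ?exprn_ge0// ltW.
have le1 : EE p2 H (fun F2 => (sparse (F1 :|: F2))%:R) <= 1.
  rewrite -[leRHS](EE_cst p2 H 1); apply: EE_le => // F2 _; by case: sparse.
case: ltP => hMl /=; last case: ltP => hL /=; rewrite ?EE_cst.
- by apply: le_trans le1 _; rewrite -addrA lerDl addr_ge0.
- by rewrite add0r; apply: le_trans le1 _; rewrite lerDl.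
- by rewrite !add0r; apply: sprinkle_large_components.
Qed.

End BoundedCase.

(** * Removing the vertices of large degree *)

(** In a minimal subgraph of minimum degree at least [r], an edge whose ends both exceed degree [r]
    could still be removed. *)
Lemma minimal_subgraph (V : finType) (E0 : {set {set V}}) r :
  (forall v, r <= #|nb E0 v|) ->
  exists E : {set {set V}}, [/\ E \subset E0, forall v, r <= #|nb E v| &
    forall u v, [set u; v] \in E -> #|nb E u| = r \/ #|nb E v| = r].
Proof.
move=> hr; pose P (E : {set {set V}}) := [forall v, r <= #|nb E v|].
have [|E /minsetP[/forallP hE minE] EE0] := @minset_exists _ P E0; first exact/forallP.
exists E; split=> // u v uvE.
have [/eqP|/negbTE ur] := boolP (#|nb E u| == r); first by left.
have [/eqP|/negbTE vr] := boolP (#|nb E v| == r); first by right.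
suff PE : P (E :\ [set u; v]).
  by have := minE _ PE (subD1set _ _) => /setP/(_ [set u; v]); rewrite !inE eqxx uvE.
apply/forallP => w.
have sub z : [set w; z] \in E -> [set w; z] = [set u; v] -> w \in [set u; v] by move=> _ <-; rewrite set21.
have [wuv|wuv] := boolP (w \in [set u; v]); last first.
  apply: leq_trans (hE w) _; apply/subset_leq_card/subsetP => z; rewrite !inE => wz.
  rewrite wz andbT; apply: contra wuv => /eqP E'; exact: sub E'.
have ltw : r < #|nb E w|.
  rewrite ltn_neqAle hE andbT eq_sym; move: wuv; rewrite !inE => /orP[]/eqP->.
    by rewrite ur.
  by rewrite vr.
have [w' w'E] : exists w', [set u; v] = [set w; w'].
  by move: wuv; rewrite !inE => /orP[]/eqP->; [exists v|exists u; rewrite setUC].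
rewrite -ltnS; apply: leq_trans ltw _; rewrite -add1n.
have inj z : [set w; z] = [set w; w'] -> z = w'.
  have [->|zw] := eqVneq z w; last exact: set2_inj.
  by move/setP/(_ w'); rewrite setUid !inE eqxx orbT => /eqP.
apply: leq_trans (_ : (w' \in nb E w) + #|nb E w :\ w'| <= _); first by rewrite -cardsD1.
apply: leq_add; first by case: (_ \in _).
apply/subset_leq_card/subsetP => z; rewrite !inE => /andP[zw' wz]; rewrite wz andbT.
by apply: contra zw'; rewrite w'E => /eqP/inj->.
Qed.

Section Hubs.
Variables (V : finType) (E : {set {set V}}) (r M d m : nat).
Implicit Types (A B D U : {set V}) (u v w : V).
Hypothesis E2 : forall e, e \in E -> #|e| = 2.
Hypothesis degr : forall v, r <= #|nb E v|.
Hypothesis degmin : forall u v, [set u; v] \in E -> #|nb E u| = r \/ #|nb E v| = r.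
Hypotheses (r0 : 0 < r) (M2 : 2 <= M) (d0 : 0 < d) (m0 : 0 < m).

Definition vol D : nat := \sum_(v in D) #|nb E v|.

Lemma nb_sym u v : (u \in nb E v) = (v \in nb E u).
Proof. by rewrite !inE setUC. Qed.

Lemma double_count D : \sum_v #|nb E v :&: D| = vol D.
Proof.
rewrite /vol; under eq_bigr do rewrite -sum1_card big_mkcond.
rewrite exchange_big /= [RHS]big_mkcond; apply: eq_bigr => v _.
case: (boolP (v \in D)) => vD; last by rewrite big1// => w _; rewrite inE (negbTE vD) andbF.
by rewrite -sum1_card [RHS]big_mkcond; apply: eq_bigr => w _; rewrite inE vD andbT nb_sym.
Qed.

Lemma card_edges : #|E| <= r * #|V|.
Proof.
apply: (@leq_trans #|\bigcup_(v in [set v | #|nb E v| == r]) star v (nb E v)|).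
  apply/subset_leq_card/subsetP => e eE; have /eqP/cards2P[x [y [_ ee]]] := E2 eE.
  rewrite ee in eE *; apply/bigcupP; case: (degmin eE) => h.
    by exists x; rewrite ?inE ?h//; apply: imset_f; rewrite inE.
  by exists y; rewrite ?inE ?h// setUC; apply: imset_f; rewrite inE setUC.
apply: leq_trans (leq_card_bigcup _ _) _.
apply: (@leq_trans (\sum_(v in [set v | #|nb E v| == r]) r)).
  by apply: leq_sum => v; rewrite inE => /eqP h; apply: leq_trans (leq_imset_card _ _) _; rewrite h.
by rewrite sum_nat_const mulnC leq_mul2l max_card orbT.
Qed.

(** Every neighbour of a vertex of degree above [r] has degree [r], so by double counting such
    vertices have no more volume than those of degree [r]. *)
Lemma vol_setT : vol setT <= 2 * r * #|V|.
Proof.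
pose L := [set v | #|nb E v| == r].
have volL : vol L <= r * #|V|.
  rewrite /vol (eq_bigr (fun=> r)); last by move=> v; rewrite inE => /eqP.
  by rewrite sum_nat_const mulnC leq_mul2l max_card orbT.
have volR : vol (~: L) <= r * #|V|.
  apply: leq_trans volL; rewrite -(double_count L) /vol big_mkcond; apply: leq_sum => v _.
  rewrite inE; case: ifP => // vL; apply/subset_leq_card/subsetP => w wn.
  by rewrite inE wn inE; move: wn vL; rewrite !inE => /degmin[->|->]; rewrite eqxx.
rewrite -mulnA mul2n -addnn; apply: leq_trans (leq_add volL volR).
by rewrite /vol [X in X <= _](bigID (fun v => v \in L)) /=; apply: eq_leq; congr (_ + _);
   apply: eq_bigl => v; rewrite !inE.
Qed.

Definition hubs : {set V} := [set v | M * r <= #|nb E v|].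

Lemma card_hubs : M * #|hubs| <= 2 * #|V|.
Proof.
rewrite -(leq_pmul2l r0).
apply: leq_trans (_ : vol setT <= _); last by apply: leq_trans vol_setT _; rewrite mulnCA mulnA.
apply: (@leq_trans (vol hubs)); last by rewrite /vol [leqRHS](big_setID hubs) /= setTI leq_addr.
rewrite mulnCA mulnA mulnC -sum_nat_const; apply: leq_sum => v.
by rewrite inE.
Qed.

Definition near_hubs : {set V} := [set v | (v \notin hubs) && (d <= #|nb E v :&: hubs|)].

(* A vertex of [good i.+1] has most of its neighbours in [good i], so that an
   exploration from it survives [i.+1] steps. The bad sets are controlled through
   their volume: their cardinality could grow by a factor [M] at each level. *)
Fixpoint bad i : {set V} :=
  if i is i'.+1 then bad i' :|: [set v | (v \notin hubs) && (#|nb E v| <= m * #|nb E v :&: bad i'|)]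
  else near_hubs.

Definition good i : {set V} := ~: (hubs :|: bad i).

Definition hubless : {set {set V}} := [set e in E | [disjoint e & hubs]].

(** A neighbour of a hub has degree exactly [r], which gives the base. A vertex added later sends at
    least a share [1 / m] of its edges into [bad i], so the volume added is at most [m] times that
    of [bad i]. *)
Lemma vol_bad i : vol (bad i) <= (1 + m) ^ i * (r * #|near_hubs|).
Proof.
elim: i => [|i IH] /=.
  rewrite mul1n /vol (eq_bigr (fun=> r)); first by rewrite sum_nat_const mulnC.
  move=> v; rewrite inE => /andP[vB vd].
  have /card_gt0P[w] : 0 < #|nb E v :&: hubs| by apply: leq_trans vd.
  rewrite !inE => /andP[vw wM]; have [//|wr] := degmin vw.
  by move: wM; rewrite wr -{2}(mul1n r) leq_pmul2r// leqNgt M2.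
set S := [set v | _].
apply: (@leq_trans (vol (bad i) + vol S)).
  rewrite /vol -[X in _ <= _ + X]/(vol S) big_mkcond [X in _ <= X + _]big_mkcond.
  rewrite [X in _ <= _ + X]big_mkcond -big_split; apply: leq_sum => v _.
  by rewrite inE; case: (v \in bad i); case: (v \in S); rewrite /= ?leq_addr ?addn0.
have volS : vol S <= m * vol (bad i).
  rewrite -(double_count (bad i)) big_distrr /= /vol big_mkcond; apply: leq_sum => v _.
  by rewrite inE; case: ifP => // /andP[].
rewrite expnS -mulnA; apply: leq_trans (_ : (1 + m) * vol (bad i) <= _); last by rewrite leq_mul2l IH.
by rewrite mulnDl mul1n leq_add2l.
Qed.

Lemma card_bad i : #|bad i| <= (1 + m) ^ i * #|near_hubs|.
Proof.
rewrite -(leq_pmul2l r0) mulnCA; apply: leq_trans (vol_bad i).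
by rewrite mulnC -sum_nat_const; apply: leq_sum => v _.
Qed.

Lemma good_sub i : good i.+1 \subset good i.
Proof. by rewrite /good setCS /= setUA subsetUl. Qed.

Lemma nb_hubless v : v \notin hubs -> nb hubless v = nb E v :\: hubs.
Proof.
move=> vB; apply/setP => w; rewrite !inE andbC; congr (_ && _).
by rewrite disjoints_subset subUset !sub1set !inE; move: vB; rewrite inE => ->.
Qed.

Lemma degree_hubless v : #|nb hubless v| <= M * r.
Proof.
have [vB|vB] := boolP (v \in hubs).
  rewrite (_ : nb hubless v = set0) ?cards0//; apply/setP => w; rewrite !inE.
  apply/negbTE; rewrite negb_and; apply/orP; right.
  by rewrite disjoints_subset subUset negb_and sub1set inE vB.
have : #|nb E v| < M * r by move: vB; rewrite inE -ltnNge.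
by move/ltnW; apply: leq_trans; rewrite nb_hubless// subset_leq_card// subsetDl.
Qed.

Lemma near_hubs_bad i : near_hubs \subset bad i.
Proof. by elim: i => //= i IH; apply: subset_trans IH (subsetUl _ _). Qed.

Lemma good_nbrs i v : v \in good i.+1 ->
  m.-1 * r <= m * (#|nb E v :&: good i| + d).
Proof.
rewrite in_setC in_setU negb_or => /andP[vB].
rewrite /= in_setU negb_or => /andP[vbad0 vbad].
have vnb : #|nb E v :&: hubs| < d.
  have : v \notin near_hubs by apply: contra vbad0; apply: (subsetP (near_hubs_bad i)).
  by rewrite inE vB /= -ltnNge.
have hD : m * #|nb E v :&: bad i| < #|nb E v|.
  by move: vbad; rewrite inE vB /= -ltnNge.
have split : #|nb E v| <= #|nb E v :&: good i| + #|nb E v :&: hubs| + #|nb E v :&: bad i|.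
  apply: (@leq_trans #|(nb E v :&: good i) :|: (nb E v :&: hubs) :|: (nb E v :&: bad i)|).
    apply/subset_leq_card/subsetP => w wn; rewrite !in_setU !in_setI wn /= in_setC in_setU.
    by case: (w \in hubs); case: (w \in bad i).
  apply: leq_trans (leq_card_setU _ _) _; rewrite leq_add2r.
  by apply: leq_trans (leq_card_setU _ _) _.
have := degr v; move: vnb hD split m0; case: m => // k; rewrite /=; clear; nia.
Qed.

End Hubs.

(** * Probability bounds from the structure around hubs *)

Section Cases.
Local Open Scope ring_scope.
Variables (R : realFieldType) (V : finType) (E : {set {set V}}) (r M d m : nat).

Local Notation hubs := (hubs E r M).
Local Notation near_hubs := (near_hubs E r M d).
Local Notation good := (good E r M d m).
Local Notation hubless := (hubless E r M).

Lemma hub_case (p : R) : 0 <= p <= 1 -> hub_rate p d <= 1 ->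
  EE p E (fun F => (sparse F)%:R) <=
    (1 - hub_rate p d / 2) ^+ #|near_hubs| * 2 ^+ (16 * #|hubs|).
Proof.
move=> p01 rate1.
pose N v := odflt set0 [pick B : {set V} | (B \subset nb E v :&: hubs) && (#|B| == d)].
have NP v : v \in near_hubs -> [/\ N v \subset hubs, #|N v| = d & N v \subset nb E v].
  rewrite inE => /andP[_ /exists_subset_card[B BS Bd]]; rewrite /N.
  case: pickP => [C /andP[CS /eqP Cd]|/(_ B)]; last by rewrite BS Bd eqxx.
  by split=> //=; apply: subset_trans CS _; rewrite ?subsetIl ?subsetIr.
have dis : [disjoint near_hubs & hubs].
  by rewrite disjoints_subset; apply/subsetP => v; rewrite inE => /andP[vh _]; rewrite inE.
have := @hub_bound R V p d hubs N p01 rate1 near_hubs dis.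
move=> /(_ (fun a aA => conj (let: And3 h _ _ := NP a aA in h) (let: And3 _ h _ := NP a aA in h))).
apply: le_trans; apply: EE_antimono => //.
  apply/bigcupsP => v /NP[_ _ sub]; apply/subsetP => e /imsetP[w /(subsetP sub)].
  by rewrite inE => h ->.
by move=> F1 F2 FF; rewrite ler_nat; case: (boolP (sparse F2)) => // /(sparse_sub FF) ->.
Qed.

Lemma hubs_ge : near_hubs != set0 -> (d <= #|hubs|)%N.
Proof.
move=> /set0Pn[v]; rewrite inE => /andP[_ h]; apply: leq_trans h _.
exact/subset_leq_card/subsetIr.
Qed.

Lemma good_pairs k dd : (forall v, v \in good k.+1 -> (dd <= #|nb E v :&: good k|)%N) ->
  (#|good k.+1| * dd <= #|edge_pairs hubless (good k)|)%N.
Proof.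
move=> h; set S := edge_pairs _ _.
have gh i u : u \in good i -> u \notin hubs by rewrite in_setC in_setU => /norP[].
have -> : #|S| = (\sum_v #|[set w | (v, w) \in S]|)%N.
  rewrite (eq_bigr (fun v => \sum_(w | (v, w) \in S) 1)%N); last first.
    by move=> v _; rewrite sum1_card cardsE.
  by rewrite pair_big_dep /= -sum1_card; apply: eq_bigl => -[].
rewrite -sum_nat_const big_mkcond; apply: leq_sum => v _; case: ifP => // vg.
apply: leq_trans (h v vg) _; apply/subset_leq_card/subsetP => w.
rewrite in_setI => /andP[vw wg]; rewrite 2!inE /= wg (subsetP (good_sub _ _ _ _ _ _) v vg) /=.
have := nb_hubless (gh _ _ vg) => /setP/(_ w).
by rewrite [w \in nb hubless v]inE => ->; rewrite inE vw (gh k w wg).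
Qed.

(** The surplus [K] in the number of good neighbours pays for the fewer than [K] vertices already
    explored. *)
Lemma good_large (p g : R) K dd v : 0 <= p <= 1 -> 0 <= g <= 1 ->
  (1 - p * g) ^+ dd <= 1 - g ->
  (forall i v, v \in good i.+1 -> (dd + K <= #|nb E v :&: good i|)%N) -> v \in good K ->
  g <= EE p hubless (fun F => (v \in large K F)%:R).
Proof.
move=> p01 /andP[g0 g1] hg hgood vg.
have gh i u : u \in good i -> u \notin hubs by rewrite in_setC in_setU => /norP[].
have x01 : 0 <= 1 - g <= 1 by rewrite subr_ge0 g1 gerBl.
have dx : (1 - p + p * (1 - g)) ^+ dd <= 1 - g by rewrite (_ : 1 - p + _ = 1 - p * g)//; ring.
have := @component_large R V p (1 - g) dd K hubless good p01 x01 dx (@good_sub V E r M d m) _ v vg.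
have -> : 1 - (1 - g) = g by ring.
move=> h; apply: le_trans (h _) _ => [i u U ug UK _|]; last first.
  by apply: EE_le => // F _; rewrite inE.
have sub : (nb E u :&: good i) :\: U \subset
    [set w in good i | ([set u; w] \in hubless) && (w \notin U)].
  apply/subsetP => w; rewrite in_setD in_setI => /and3P[wU uw wg].
  rewrite inE wg wU andbT /=.
  have := nb_hubless (gh _ _ ug) => /setP/(_ w).
  by rewrite [w \in nb hubless u]inE => ->; rewrite inE uw (gh i w wg).
apply: leq_trans (subset_leq_card sub); rewrite cardsD leq_subRL.
  apply: leq_trans (hgood i u ug); rewrite addnC leq_add2l; apply: leq_trans (ltnW UK).
  exact/subset_leq_card/subsetIr.
exact/subset_leq_card/subsetIl.
Qed.

End Cases.

Section Survival.
Local Open Scope ring_scope.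

(** For [g = b / (1 + b)], [expr_bernoulli] bounds the power by [1 / (1 + k p g)]. As [k p g] is at
    least [(1 + b) g = b], this is at most [1 / (1 + b) = 1 - g]. *)
Lemma survival (R : realFieldType) (p b : R) k : 0 <= p <= 1 -> 0 < b ->
  1 + b <= k%:R * p -> (1 - p * (b / (1 + b))) ^+ k <= 1 - b / (1 + b).
Proof.
move=> /andP[p0 p1] b0 hk; set g := b / (1 + b).
have b1 : 0 < 1 + b by lra.
have g0 : 0 <= g by rewrite divr_ge0// ltW.
have g1 : g <= 1 by rewrite ler_pdivrMr// mul1r lerDr.
have z01 : 0 <= p * g <= 1 by rewrite mulr_ge0//= mulr_ile1.
have := expr_bernoulli k z01; set X := _ ^+ k => hX.
have X0 : 0 <= X by rewrite exprn_ge0// subr_ge0; case/andP: z01.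
have gE : 1 - g = 1 / (1 + b) by rewrite /g; field; rewrite gt_eqF.
rewrite gE ler_pdivlMr//; apply: le_trans hX; rewrite ler_wpM2l// lerD2l.
rewrite mulrA; apply: le_trans (_ : (1 + b) * g <= _); first by rewrite /g mulrC divfK ?gt_eqF.
by rewrite ler_wpM2r.
Qed.


End Survival.

Section Numerics.
Local Open Scope ring_scope.
Variable R : realFieldType.

Lemma bernoulli_ge (z : R) k : 0 <= z <= 1 -> 1 - k%:R * z <= (1 - z) ^+ k.
Proof.
move=> /andP[z0 z1]; elim: k => [|k IH]; first by rewrite expr0 mul0r subr0.
rewrite exprS -natr1; apply: (@le_trans _ _ ((1 - z) * (1 - k%:R * z))).
  have k0 : 0 <= k%:R :> R by []. nra.
by rewrite ler_wpM2l// subr_ge0.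
Qed.

(** Up to constants the rate is [(d * p) ^+ 2], and [d * p] is of constant order when [d] is a
    constant fraction of [r]. *)
Lemma hub_rate_bounds (p : R) d D : 0 <= p <= 1 -> (66 <= d)%N -> (0 < D)%N ->
  d%:R * p <= 1 / 2 -> 1 <= (2 * D)%:R * (d%:R * p) ->
  1 / (32 * D%:R ^+ 2) <= hub_rate p d <= 1.
Proof.
move=> p01 d66 D0 dp Dp; have /andP[p0 p1] := p01.
have D0' : 0 < D%:R :> R by rewrite ltr0n.
(* The lower bound is an equality at [d = 66], the origin of that threshold. *)
have hC : (d ^ 2 <= 4 * ('C(d, 2) - 16 * d) <= 4 * d ^ 2)%N.
  rewrite bin2; have := odd_double_half (d * d.-1).
  rewrite oddM; case: d d66 {dp Dp} => // d d66; rewrite /= andNb add0n -muln2 -mulnn.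
  by move: (_./2) => h; nia.
have /andP[hC1 hC2] := hC.
have {}hC1 : d%:R ^+ 2 <= 4 * ('C(d, 2) - 16 * d)%:R :> R by rewrite -natrX -natrM ler_nat.
have {}hC2 : 4 * ('C(d, 2) - 16 * d)%:R <= 4 * d%:R ^+ 2 :> R.
  by rewrite -natrX -!natrM ler_nat.
rewrite /hub_rate; move: ('C(d, 2) - 16 * d)%:R hC1 hC2 => c hC1 hC2.
have c0 : 0 <= c by have := exprn_ge0 2 (ler0n R d); lra.
have d0 : 0 <= d%:R :> R by [].
have X1 : (1 - p) ^+ (d - 2) <= 1 by rewrite exprn_ile1// ?subr_ge0// gerBl.
have X0 : 1 / 2 <= (1 - p) ^+ (d - 2).
  apply: le_trans (bernoulli_ge (d - 2) p01).
  have : (d - 2)%:R * p <= d%:R * p by rewrite ler_wpM2r// ler_nat leq_subr.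
  lra.
move: ((1 - p) ^+ _) X0 X1 => X X0 X1.
have pc : (d%:R * p) ^+ 2 / 4 <= p ^+ 2 * c <= (d%:R * p) ^+ 2.
  have p20 : 0 <= p ^+ 2 by rewrite exprn_ge0.
  by rewrite exprMn; apply/andP; split; nra.
have -> : p ^+ 2 * X * c = X * (p ^+ 2 * c) by ring.
move: (d%:R * p) dp Dp pc (mulr_ge0 d0 p0) => y dp Dp /andP[pc1 pc2] y0.
move: (p ^+ 2 * c) pc1 pc2 => w pc1 pc2; apply/andP; split; last by nra.
rewrite ler_pdivrMr ?mulr_gt0 ?exprn_gt0//.
have h1 : 1 <= (2 * D%:R * y) ^+ 2 by rewrite expr_ge1// -natrM; lra.
have h2 : y ^+ 2 / 8 <= X * w by nra.
apply: le_trans h1 _.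
have D2 : 0 <= 32 * D%:R ^+ 2 :> R by rewrite mulr_ge0// exprn_ge0.
by have := ler_wpM2l D2 h2; rewrite mulrC [leRHS]mulrC; nra.
Qed.

Lemma pow_small (z e : R) : 0 < z <= 1 -> 0 < e -> forall k, 1 / (e * z) <= k%:R ->
  (1 - z) ^+ k <= e.
Proof.
move=> /andP[z0 z1] e0 k hk.
have z01 : 0 <= z <= 1 by rewrite ltW.
have := expr_bernoulli k z01; set X := _ ^+ k => hX.
have X0 : 0 <= X by rewrite exprn_ge0// subr_ge0.
have kz : 1 <= e * (k%:R * z).
  by move: hk; rewrite ler_pdivrMr ?mulr_gt0// => h; apply: le_trans h _; nra.
have k0 : 0 <= k%:R * z by rewrite mulr_ge0// ltW.
move: (k%:R * z) hX kz k0 => y hX kz y0; nra.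
Qed.

(** With [16 * k] exposed vertices per hub, the decay [(1 / 4) ^+ (16 * h)] beats the potential
    [2 ^+ (16 * h)]. *)
Lemma hub_power (s c : R) t h k : 0 < c -> c <= s <= 1 -> (1 - c / 2) ^+ k <= 1 / 4 ->
  (16 * k * h <= t)%N -> (1 - s / 2) ^+ t * 2 ^+ (16 * h) <= (1 / 2) ^+ h.
Proof.
move=> c0 /andP[cs s1] hk ht.
have s0 : 0 <= 1 - s / 2 by lra.
have c1 : 0 <= 1 - c / 2 by lra.
have h1 : (1 - s / 2) ^+ t <= (1 - c / 2) ^+ (16 * k * h).
  apply: (@le_trans _ _ ((1 - s / 2) ^+ (16 * k * h))).
    by apply: ler_wiXn2l => //; lra.
  by apply: lerXn2r; rewrite ?nnegrE//; lra.
have h2 : (1 - c / 2) ^+ (16 * k * h) <= (1 / 4) ^+ (16 * h).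
  rewrite (_ : 16 * k * h = k * (16 * h))%N; last by rewrite mulnAC mulnC.
  by rewrite exprM; apply: lerXn2r; rewrite ?nnegrE ?exprn_ge0//; lra.
apply: (@le_trans _ _ ((1 / 4) ^+ (16 * h) * 2 ^+ (16 * h))).
  by rewrite ler_wpM2r ?exprn_ge0// (le_trans h1).
rewrite -exprMn (_ : 1 / 4 * 2 = 1 / 2 :> R); last by field.
by apply: ler_wiXn2l; [lra|lra|rewrite -[X in (X <= _)%N]mul1n leq_mul2r orbT].
Qed.

End Numerics.

(** * Sprinkling after the removal of the hubs *)

Section NoHubs.
Local Open Scope ring_scope.

(** The excess [4 * b] in [p * r] is shared equally by the two rounds. By [hdd] the first one keeps
    a branching mean of [1 + b] on the [dd] neighbours that remain. *)
Lemma no_hub_case (R : realFieldType) (V : finType) (E : {set {set V}}) (r M d m K T dd : nat)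
    (p b C k g c : R) :
  (forall e, e \in E -> #|e| = 2) -> (forall v, (r <= #|nb E v|)%N) ->
  (forall u v, [set u; v] \in E -> #|nb E u| = r \/ #|nb E v| = r) ->
  (2 <= r)%N -> (0 < m)%N -> (0 < K)%N -> (0 < T)%N -> (r <= #|V|)%N ->
  0 < b -> b <= 1 / 4 -> 0 < k -> g = b / (1 + b) -> c = g ^+ 2 / 64 ->
  (1 + 4 * b) / r%:R <= p -> p <= 1 -> p * (T ^ 2)%:R <= 1 ->
  32 < b * c * K%:R ->
  0 < C -> (1 + (1 + 2 * b) / r%:R) ^+ (M * r) <= C ->
  60 * 32 * M%:R * K%:R ^+ 2 * C / k <= g ^+ 2 * T%:R ->
  64 * T%:R <= g ^+ 2 * r%:R ->
  24 * 32 ^+ 2 * K%:R ^+ 2 * M%:R ^+ 2 <= k * g ^+ 4 * #|V|%:R ->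
  96 <= k * b * c ^+ 2 * #|V|%:R ->
  (1 + b) * r%:R <= dd%:R * (1 + 2 * b) -> (r <= 2 * dd)%N ->
  (m * (dd + K + d) <= m.-1 * r)%N ->
  (4 * #|hubs E r M| <= #|V|)%N -> (4 * #|bad E r M d m K.+1| <= #|V|)%N ->
  EE p (hubless E r M) (fun F => (sparse F)%:R) <= k.
Proof.
move=> E2 degr degmin r2 m0 K0 T0 rn b0 b1 k0 gE cE pr ple1 pT hK C0 hC hT hrT hn1 hn3 hdd hdd4 hgood hhubs hbad.
pose rr : R := r%:R; pose n : R := #|V|%:R; pose p1 : R := (1 + 2 * b) / rr.
rewrite -/rr in pr hC hrT hdd; rewrite -/n in hn1 hn3; rewrite -/p1 in hC.
have r0 : (0 < r)%N by apply: ltn_trans r2.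
have rr0 : 0 < rr by rewrite ltr0n.
have n0 : 0 < n by rewrite ltr0n (leq_trans r0).
have rr2 : 2 <= rr by rewrite ler_nat.
have b1' : 0 < 1 + b by rewrite addr_gt0.
have g0 : 0 < g by rewrite gE divr_gt0.
have g1 : g <= 1 by rewrite gE ler_pdivrMr// mul1r lerDr.
have c0 : 0 < c by rewrite cE divr_gt0// exprn_gt0.
have p1_gt0 : 0 < p1 by apply: divr_gt0 => //; rewrite addr_gt0// mulr_gt0.
have p1lt1 : p1 < 1 by rewrite ltr_pdivrMr// mul1r -/rr; move: rr2 b1; clear; lra.
have p1_01 : 0 <= p1 <= 1 by rewrite !ltW.
have p1p : p1 + 2 * b / rr <= p.
  by apply: le_trans pr; rewrite /p1 -mulrDl ler_wpM2r ?invr_ge0 ?(ltW rr0)//; lra.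
have br0 : 0 < 2 * b / rr by rewrite divr_gt0// mulr_gt0.
have q1 : 0 < 1 - p1 by lra.
pose p2 := (p - p1) / (1 - p1).
have p2ge : 2 * b / rr <= p2.
  rewrite ler_pdivlMr//; apply: (@le_trans _ _ (2 * b / rr)); last by rewrite lerBrDl.
  by rewrite ler_piMr ?gerBl ?(ltW br0) ?(ltW p1_gt0).
have p2_gt0 : 0 < p2 by apply: lt_le_trans p2ge.
have p2lep : p2 <= p by rewrite ler_pdivrMr// mulrBr mulr1 lerD2l lerN2 ler_piMl// ltW.
have p2_01 : 0 <= p2 <= 1 by rewrite ltW//=; apply: le_trans ple1.
have pE : 1 - p = (1 - p1) * (1 - p2) by rewrite /p2; field; rewrite gt_eqF.
have degH := @degree_hubless V E r M.
have H2 e : e \in hubless E r M -> #|e| = 2 by rewrite inE => /andP[/E2].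
have Hn : #|hubless E r M|%:R <= rr * n.
  rewrite -natrM ler_nat; apply: leq_trans (card_edges E2 degmin).
  by apply/subset_leq_card/subsetP => e; rewrite inE => /andP[].
have hgd i v : v \in good E r M d m i.+1 -> (dd + K <= #|nb E v :&: good E r M d m i|)%N.
  move=> vg; have := good_nbrs degr m0 vg => h.
  have := leq_trans hgood h; by rewrite leq_pmul2l // leq_add2r.
have g01 : 0 <= g <= 1 by rewrite ltW.
have surv : (1 - p1 * g) ^+ dd <= 1 - g.
  by rewrite gE; apply: survival => //; rewrite /p1 mulrA ler_pdivlMr.
have goodP v : v \in good E r M d m K -> g <= EE p1 (hubless E r M) (fun F => (v \in large K F)%:R).
  exact: (good_large p1_01 g01 surv hgd).
(* At least half of the vertices lie in [good K.+1], each with at least [r / 2] neighbours in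
   [good K]; this yields [n * rr / 4] pairs, of which half are claimed. *)
pose Mu := g ^+ 2 * n * rr / 8.
have Mu0 : 0 < Mu by rewrite divr_gt0// !mulr_gt0// exprn_gt0.
have hMu : Mu <= g ^+ 2 * #|edge_pairs (hubless E r M) (good E r M d m K)|%:R.
  rewrite (_ : Mu = g ^+ 2 * (n * rr / 8)); last by rewrite /Mu !mulrA.
  apply: ler_wpM2l; first exact/exprn_ge0/ltW.
  rewrite ler_pdivrMr// -!natrM ler_nat.
  have hgp := @good_pairs V E r M d m K dd.
  have hgp' := hgp _; have {hgp hgp'} := hgp' (fun v vg => leq_trans (leq_addr K dd) (hgd K v vg)).
  have hg2 : (#|V| <= 2 * #|good E r M d m K.+1|)%N.
    have := cardsC (hubs E r M :|: bad E r M d m K.+1); rewrite -/(good E r M d m K.+1).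
    have := leq_of_leqif (leq_card_setU (hubs E r M) (bad E r M d m K.+1)).
    move: hhubs hbad; rewrite /good.
    move: #|hubs _ _ _| #|bad _ _ _ _ _ _| #|_ :|: _| #|~: _| #|V| => x y z w t; clear; lia.
  move: hg2 hdd4; move: #|good _ _ _ _ _ K.+1| #|edge_pairs _ _| #|V| => x y t; clear; nia.
(* Makes the Markov bound for the degrees at most [k / 3]; each of the three failures gets a third
   of [k]. *)
pose L := 3 * C / k.
have L0 : 0 < L by rewrite divr_gt0// mulr_gt0.
(* An eighth of [Mu]: then [Mu / 2] covers [U] and two losses of at most [U] each. *)
pose U := c * n * rr.
have U0 : 0 < U by rewrite !mulr_gt0.
have TR0 : 0 < T%:R :> R by rewrite ltr0n.
have hU : U + (2 * (M * r))%:R * (5 * K ^ 2)%:R * (L * n) / T%:R + (T * #|V|)%:R <= Mu / 2.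
  have h1 : (2 * (M * r))%:R * (5 * K ^ 2)%:R * (L * n) / T%:R <= U.
    rewrite ler_pdivrMr// !natrM -/rr /U cE.
    have -> : 2 * (M%:R * rr) * (5 * (K%:R * K%:R)) * (L * n) =
       (60 * 32 * M%:R * K%:R ^+ 2 * C / k) * (n * rr) / 64 by rewrite /L; field; rewrite gt_eqF.
    rewrite ler_pdivrMr//.
    have -> : g ^+ 2 / 64 * n * rr * T%:R * 64 = g ^+ 2 * T%:R * (n * rr) by field.
    by rewrite ler_wpM2r// mulr_ge0// ltW.
  have h2 : (T * #|V|)%:R <= U.
    rewrite natrM -/n /U cE (_ : g ^+ 2 / 64 * n * rr = g ^+ 2 * rr / 64 * n); last by ring.
    by apply: ler_wpM2r; [exact: ltW|rewrite ler_pdivlMr// mulrC].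
  have -> : Mu / 2 = U + U + U + U by rewrite /Mu /U cE; field.
  by apply: le_trans (lerD (lerD (lexx U) h1) h2) _; rewrite lerDl ltW.
have p2T : p2 * (T ^ 2)%:R <= 1 by apply: le_trans pT; rewrite ler_wpM2r.
have KR0 : 0 < K%:R :> R by rewrite ltr0n.
have dense : 16 * n / K%:R < p2 * U / 4.
  rewrite ltr_pdivrMr//; apply: (@lt_le_trans _ _ (2 * b / rr * U / 4 * K%:R)).
    rewrite (_ : 2 * b / rr * U / 4 * K%:R = b * c * K%:R * n / 2); last first.
      by rewrite /U; field; rewrite gt_eqF.
    by rewrite ltr_pdivlMr// mulrAC ltr_pM2r//; move: hK; clear; lra.
  apply: ler_wpM2r; first exact: ltW.
  by rewrite !ler_pM2r ?invr_gt0.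
have V0 : (0 < #|V|)%N by apply: leq_trans rn.
have := bounded_degree_bound H2 degH K0 T0 V0 p1_01 p2_01 p2_gt0 pE g0 goodP Mu0 hMu L0 U0 hU p2T dense.
move=> h; apply: le_trans h _.
have t1 : 4 * (#|hubless E r M|%:R * p1 * (4 * K * (M * r))%:R ^+ 2) / Mu ^+ 2 <= k / 3.
  have hX : (4 * K * (M * r))%:R = 4 * K%:R * (M%:R * rr) :> R by rewrite !natrM.
  rewrite hX ler_pdivrMr ?exprn_gt0//.
  have p1le : p1 <= 2 / rr.
    by apply: ler_wpM2r; [rewrite invr_ge0 ltW|move: b1; clear; lra].
  have hHp : #|hubless E r M|%:R * p1 <= 2 * n.
    apply: (@le_trans _ _ (rr * n * (2 / rr))).
      by apply: ler_pM => //; exact: ltW.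
    by rewrite le_eqVlt; apply/orP; left; apply/eqP; field; rewrite gt_eqF.
  apply: (@le_trans _ _ (4 * (2 * n * (4 * K%:R * (M%:R * rr)) ^+ 2))).
    apply: ler_wpM2l => //; apply: ler_wpM2r => //; rewrite exprn_ge0// !mulr_ge0// ltW//.
  rewrite (_ : 4 * _ = 24 * 32 ^+ 2 * K%:R ^+ 2 * M%:R ^+ 2 * (n * rr ^+ 2) / (3 * 64)); last by field.
  rewrite (_ : k / 3 * Mu ^+ 2 = k * g ^+ 4 * n * (n * rr ^+ 2) / (3 * 64)); last by rewrite /Mu; field.
  apply: ler_wpM2r; first by rewrite invr_ge0 mulr_ge0.
  by apply: ler_wpM2r => //; rewrite mulr_ge0 ?exprn_ge0// ltW.
have t2 : (1 + p1) ^+ (M * r) / L <= k / 3.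
  rewrite ler_pdivrMr// (_ : k / 3 * L = C)//.
  by rewrite /L; field; rewrite gt_eqF.
have t3 : 64 * #|hubless E r M|%:R / (p2 * U ^+ 2) <= k / 3.
  rewrite ler_pdivrMr; last by rewrite mulr_gt0// exprn_gt0.
  apply: (@le_trans _ _ (64 * (rr * n))); first by rewrite ler_wpM2l.
  apply: (@le_trans _ _ (k / 3 * (2 * b / rr * U ^+ 2))); last first.
    by rewrite ler_pM2l ?divr_gt0// ler_wpM2r// exprn_ge0// ltW.
  rewrite (_ : k / 3 * _ = k * b * c ^+ 2 * n * (rr * n) * (2 / 3)); last first.
    by rewrite /U; field; rewrite gt_eqF.
  have : 96 * (rr * n) <= k * b * c ^+ 2 * n * (rr * n) by rewrite ler_wpM2r// mulr_ge0// ltW.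
  by move: (k * b * c ^+ 2 * n * (rr * n)) (rr * n) => x y; clear; lra.
apply: (le_trans (lerD (lerD t1 t2) t3)).
by rewrite le_eqVlt; apply/orP; left; apply/eqP; field.
Qed.

End NoHubs.

(** * A plane drawing has no complete minor on five vertices *)

Section CrossingParity.
Local Open Scope ring_scope.
Variable R : realFieldType.
Implicit Types (u v a b q : R * R) (s t : seq (R * R)) (d : R).

(** The lexicographic tie-break makes this sign odd on all nonzero vectors, so no general position
    is required. *)
Definition lexpos u := (0 < u.2) || ((u.2 == 0) && (0 < u.1)).
(** A discrete test for the segment from [u] to [v] crossing the positive horizontal half axis.
    Looking at [u.1] alone is enough for short segments far from the origin. *)
Definition crossing u v := (0 < u.1) && xorb (lexpos u) (lexpos v).
Definition distant d u := (d <= `|u.1|) || (d <= `|u.2|).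
Definition nearby d u v := (`|u.1 - v.1| < d) && (`|u.2 - v.2| < d).

Lemma near_sign (d x y : R) (k : R) : 0 < d -> `|x - y| < k -> k <= d -> d <= `|x| ->
  (0 < y) = (0 < x) /\ (y == 0) = false.
Proof.
rewrite ltr_norml => d0 /andP[h1 h2] kd; case: (ger0P x) => hx h.
  have y0 : 0 < y by lra.
  have x0 : 0 < x by lra.
  by split; [rewrite x0 y0 | apply: gt_eqF].
have y0 : y < 0 by lra.
by split; [rewrite !ltNge (ltW y0) (ltW hx) | apply: lt_eqF].
Qed.

(** The four points stay away from the origin, so both ways around the square cross the half axis
    with the same parity. The factor 3 leaves room for two steps of size [d]. *)
Lemma crossing_square d u0 u1 u2 u3 : distant (3 * d) u0 ->
  nearby d u0 u1 -> nearby d u1 u2 -> nearby d u0 u3 ->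
  xorb (crossing u0 u1) (crossing u1 u2) = xorb (crossing u0 u3) (crossing u3 u2).
Proof.
move=> hf /andP[x01 y01] /andP[x12 y12] /andP[x03 y03].
have d0 : 0 < d by apply: le_lt_trans x01.
have kd : d <= 3 * d by lra.
have kd2 : 2 * d <= 3 * d by lra.
have d3 : 0 < 3 * d by lra.
have x02 : `|u0.1 - u2.1| < 2 * d.
  have := ler_normD (u0.1 - u1.1) (u1.1 - u2.1); rewrite addrA subrK; lra.
have y02 : `|u0.2 - u2.2| < 2 * d.
  have := ler_normD (u0.2 - u1.2) (u1.2 - u2.2); rewrite addrA subrK; lra.
rewrite /crossing; case/orP: hf => hf.
  rewrite (near_sign d3 x01 kd hf).1 (near_sign d3 x03 kd hf).1.
  case: (0 < u0.1) => //=; btauto.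
have x00 : `|u0.2 - u0.2| < d by rewrite subrr normr0.
rewrite /lexpos.
have [-> ->] := near_sign d3 y01 kd hf.
have [-> ->] := near_sign d3 y02 kd2 hf.
have [-> ->] := near_sign d3 y03 kd hf.
have [_ ->] := near_sign d3 x00 kd hf.
by rewrite /= !orbF; case: (0 < u0.2); rewrite !andbF.
Qed.

Lemma lexposN d u : 0 < d -> distant d u -> lexpos (- u) = ~~ lexpos u.
Proof.
move=> d0 h; rewrite /lexpos /= !oppr_gt0 oppr_eq0.
have : (u.2 != 0) || (u.1 != 0).
  apply: contraTT h; rewrite negb_or !negbK => /andP[/eqP h1 /eqP h2].
  by rewrite /distant h1 h2 normr0 orbb -ltNge.
by case: (ltgtP u.2 0) => //= _; case: (ltgtP u.1 0).
Qed.

(** Crossings of the positive and of the negative half axis together account for the changes of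
    [lexpos]. *)
Lemma crossingN d u v : distant d u -> distant d v -> nearby d u v ->
  crossing u v = xorb (crossing (- u) (- v)) (xorb (lexpos u) (lexpos v)).
Proof.
move=> hu hv /andP[hx hy].
have d0 : 0 < d by apply: le_lt_trans hx.
rewrite /crossing (lexposN d0 hu) (lexposN d0 hv) /= oppr_gt0.
have x00 : `|u.1 - u.1| < d by rewrite subrr normr0.
have y00 : `|u.2 - u.2| < d by rewrite subrr normr0.
case/orP: (hu) => h; last first.
  have [h1 h2] := near_sign d0 hy (lexx d) h.
  have [_ h3] := near_sign d0 y00 (lexx d) h.
  rewrite /lexpos h1 h2 h3 /= !orbF.
  by case: (0 < u.2); rewrite !andbF.
have [h1 h2] := near_sign d0 x00 (lexx d) h.
case: (ltgtP u.1 0) h2 => //= _ _; btauto.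
Qed.

(** Both sums follow the difference of two points around the origin: here the first point walks, in
    [cross_sumN] the second. *)
Fixpoint cross_sum a s q : bool :=
  if s is b :: s' then xorb (crossing (a - q) (b - q)) (cross_sum b s' q) else false.

Fixpoint cross_sumN a s q : bool :=
  if s is b :: s' then xorb (crossing (q - a) (q - b)) (cross_sumN b s' q) else false.

Lemma nearBr d u v q : nearby d (u - q) (v - q) = nearby d u v.
Proof.
rewrite /nearby /= (_ : u.1 - q.1 - (v.1 - q.1) = u.1 - v.1); last by ring.
by rewrite (_ : u.2 - q.2 - (v.2 - q.2) = u.2 - v.2); last by ring.
Qed.

Lemma nearBl d u v q : nearby d (q - u) (q - v) = nearby d u v.
Proof.
rewrite /nearby /= (_ : q.1 - u.1 - (q.1 - v.1) = - (u.1 - v.1)); last by ring.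
by rewrite (_ : q.2 - u.2 - (q.2 - v.2) = - (u.2 - v.2)) ?normrN //; ring.
Qed.

Lemma cross_sumNE d a s q : path (nearby d) a s -> all (fun b => distant d (b - q)) (a :: s) ->
  cross_sumN a s q =
  xorb (cross_sum a s q) (xorb (lexpos (q - a)) (lexpos (q - last a s))).
Proof.
elim: s a => [|b s IH] a /=; first by case: lexpos.
move=> /andP[nab pbs] /and3P[fa fb fs].
rewrite IH//=; last by rewrite fb.
have fN u : distant d (u - q) -> distant d (q - u).
  by rewrite /distant -!(normrN (_ - q).1) -!(normrN (_ - q).2) /= !opprB.
rewrite (@crossingN d (q - a) (q - b)) ?fN ?nearBl// !opprB.
by move: (crossing (a - q) (b - q)) => c; btauto.
Qed.

Lemma cross_sum_step d a s b b' : path (nearby d) a s -> nearby d b b' ->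
  all (fun x => distant (3 * d) (x - b)) (a :: s) ->
  xorb (cross_sum a s b) (crossing (last a s - b) (last a s - b')) =
  xorb (crossing (a - b) (a - b')) (cross_sum a s b').
Proof.
move=> + nb; elim: s a => [|c s IH] a /=; first by move=> *; btauto.
move=> /andP[nac pcs] /and3P[fa fc fs].
have := IH c pcs; rewrite /= fc => /(_ fs) e.
have := @crossing_square d (a - b) (c - b) (c - b') (a - b') fa.
rewrite !nearBr !nearBl => /(_ nac nb nb) sq.
rewrite xorb_assoc e -!xorb_assoc; congr xorb; exact: sq.
Qed.

(** The differences of two walks that stay far apart form a grid avoiding the origin; adding up its
    squares, the two ways along its boundary have equal parity. *)
Lemma cross_sum_grid d a s b t : path (nearby d) a s -> path (nearby d) b t ->
  all (fun y => all (fun x => distant (3 * d) (x - y)) (a :: s)) (b :: t) ->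
  xorb (cross_sum a s b) (cross_sumN b t (last a s)) =
  xorb (cross_sumN b t a) (cross_sum a s (last b t)).
Proof.
move=> pa; elim: t b => [|c t IH] b /=; first by move=> *; btauto.
move=> /andP[nbc pct] /andP[fb fct].
have e := IH c pct fct.
have e1 := cross_sum_step pa nbc fb.
rewrite -xorb_assoc e1 xorb_assoc e; btauto.
Qed.

(* The van Kampen obstruction of [K_5] modulo 2: summing the identities of the
   15 pairs of disjoint edges, every crossing sum occurs twice, while the signs
   [lexpos (v i - v j)] and [lexpos (v j - v i)] differ. *)
Lemma K5_obstruction d (v : nat -> R * R) (w : nat -> nat -> seq (R * R)) : 0 < d ->
  (forall i j, (i < j < 5)%N -> path (nearby d) (v i) (w i j) /\ last (v i) (w i j) = v j) ->
  (forall i j k l, (i < j < 5)%N -> (k < l < 5)%N ->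
     [&& i != k, i != l, j != k & j != l] ->
     all (fun y => all (fun x => distant (3 * d) (x - y)) (v i :: w i j)) (v k :: w k l)) ->
  False.
Proof.
move=> d0 hw hf.
pose H i j k := cross_sum (v i) (w i j) (v k).
pose L i j := lexpos (v i - v j).
have d3 : d <= 3 * d by lra.
have d03 : 0 < 3 * d by lra.
have far3 u : distant (3 * d) u -> distant d u.
  by case/orP => h; apply/orP; [left|right]; apply: le_trans h.
have key i j k l : (i < j < 5)%N -> (k < l < 5)%N ->
     [&& i != k, i != l, j != k & j != l] ->
  xorb (xorb (xorb (H i j k) (H i j l)) (xorb (H k l i) (H k l j)))
   (xorb (xorb (L i k) (L i l)) (xorb (L j k) (L j l))) = false.
  move=> ij kl dj; have [p1 l1] := hw i j ij; have [p2 l2] := hw k l kl.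
  have f := hf i j k l ij kl dj; have := cross_sum_grid p1 p2 f.
  have fi x : x \in v i :: w i j -> all (fun b => distant d (b - x)) (v k :: w k l).
    move=> xs; apply/allP => y ys; have /allP/(_ y ys)/allP/(_ x xs)/far3 := f.
    by rewrite /distant -(normrN (x - y).1) -(normrN (x - y).2) /= !opprB.
  rewrite (@cross_sumNE d)//; last by apply: fi; rewrite mem_last.
  rewrite (@cross_sumNE d)//; last by apply: fi; rewrite mem_head.
  rewrite l1 l2 -/(H i j k) -/(H i j l) -/(H k l i) -/(H k l j).
  rewrite -/(L i k) -/(L i l) -/(L j k) -/(L j l).
  by case: (H i j k); case: (H i j l); case: (H k l i); case: (H k l j);
    case: (L i k); case: (L i l); case: (L j k); case: (L j l).
have LN i j k l : (i < j < 5)%N -> (k < l < 5)%N ->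
     [&& i != k, i != l, j != k & j != l] -> forall x y,
     x \in [:: i; j] -> y \in [:: k; l] -> L x y = negb (L y x).
  move=> ij kl dj x y hx hy; rewrite /L -(opprB (v y)) (@lexposN (3 * d))//.
  have [_ l1] := hw i j ij; have [_ l2] := hw k l kl.
  have xi : v x \in v i :: w i j.
    by move: hx; rewrite !inE => /orP[] /eqP->; [rewrite eqxx | rewrite -l1 -in_cons mem_last].
  have yk : v y \in v k :: w k l.
    by move: hy; rewrite !inE => /orP[] /eqP->; [rewrite eqxx | rewrite -l2 -in_cons mem_last].
  have /allP/(_ _ yk)/allP/(_ _ xi) := hf i j k l ij kl dj.
  by rewrite /distant -(normrN (v y - v x).1) -(normrN (v y - v x).2) /= !opprB.
have e21 : L 2 1 = negb (L 1 2) by apply: (@LN 2 3 1 4).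
have e31 : L 3 1 = negb (L 1 3) by apply: (@LN 2 3 1 4).
have e32 : L 3 2 = negb (L 2 3) by apply: (@LN 3 4 1 2).
have e41 : L 4 1 = negb (L 1 4) by apply: (@LN 3 4 1 2).
have e42 : L 4 2 = negb (L 2 4) by apply: (@LN 3 4 1 2).
have e43 : L 4 3 = negb (L 3 4) by apply: (@LN 2 4 1 3).
have sum2 (a b : bool) : a = false -> b = false -> xorb a b = false by move=> -> ->.
have := sum2 _ _ (key 0 1 2 3 isT isT isT) (key 0 1 2 4 isT isT isT).
move/sum2 => /(_ _ (key 0 1 3 4 isT isT isT)).
move/sum2 => /(_ _ (key 0 2 1 3 isT isT isT)).
move/sum2 => /(_ _ (key 0 2 1 4 isT isT isT)).
move/sum2 => /(_ _ (key 0 2 3 4 isT isT isT)).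
move/sum2 => /(_ _ (key 0 3 1 2 isT isT isT)).
move/sum2 => /(_ _ (key 0 3 1 4 isT isT isT)).
move/sum2 => /(_ _ (key 0 3 2 4 isT isT isT)).
move/sum2 => /(_ _ (key 0 4 1 2 isT isT isT)).
move/sum2 => /(_ _ (key 0 4 1 3 isT isT isT)).
move/sum2 => /(_ _ (key 0 4 2 3 isT isT isT)).
move/sum2 => /(_ _ (key 1 2 3 4 isT isT isT)).
move/sum2 => /(_ _ (key 1 3 2 4 isT isT isT)).
move/sum2 => /(_ _ (key 1 4 2 3 isT isT isT)).
(* Each pair of vertices is separated by six of the fifteen pairs of edges, so the signs cancel up
   to negations, and these number fifteen. *)
rewrite e21 e31 e32 e41 e42 e43.
set X := (X in X = false -> _).
suff -> : X = true by [].
rewrite /X; btauto.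
Qed.

End CrossingParity.

From mathcomp Require Import all_classical all_reals all_analysis.
Import numFieldNormedType.Exports.
Import Order.TTheory GRing.Theory Num.Theory.

Local Open Scope classical_set_scope.
Local Open Scope ring_scope.

(** * Discretization of continuous arcs *)

Section Chains.
Variable R : realType.
Implicit Types (d : R) (p q : R * R) (S : set (R * R)).

Lemma nearby_normE d p q : nearby d p q = (`|p - q| < d).
Proof. by rewrite prod_normE gt_max. Qed.

Lemma distant_normE d p : distant d p = (d <= `|p|).
Proof. by rewrite prod_normE le_max. Qed.

Definition chain d S p q := exists s : seq (R * R),
  [/\ path (nearby d) p s, last p s = q & forall x, x \in p :: s -> S x].

Lemma chain_trans d S p q r : chain d S p q -> chain d S q r -> chain d S p r.
Proof.
move=> [s [ps <- Ss]] [t [pt lt St]]; exists (s ++ t); split.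
- by rewrite cat_path ps.
- by rewrite last_cat.
- move=> x; rewrite -cat_cons mem_cat => /orP[/Ss//|xt].
  by apply: St; rewrite inE xt orbT.
Qed.

Lemma chain_sub d S S' p q : S `<=` S' -> chain d S p q -> chain d S' p q.
Proof. by move=> sub [s [ps ls Ss]]; exists s; split=> // x /Ss/sub. Qed.

(** The points reachable by steps shorter than [d] form a subset that is both open and closed in
    [S]. *)
Lemma connected_chain d S p q : 0 < d -> connected S -> S p -> S q -> chain d S p q.
Proof.
move=> d0 cS Sp Sq; pose B := [set z | chain d S p z].
have BS : B `<=` S.
  by move=> z [s [_ <- Ss]]; apply: Ss; rewrite mem_last.
have step y z : B y -> S z -> ball y d z -> B z.
  move=> By Sz yz; apply: (chain_trans By); exists [:: z]; split=> //=.
    by rewrite nearby_normE andbT; move: yz; rewrite -ball_normE.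
  by move=> x; rewrite !inE => /orP[/eqP->|/eqP->//]; apply: BS.
suff BE : B = S by have : B q by rewrite BE.
apply: cS.
- by exists p, [::]; split=> // x; rewrite inE => /eqP->.
- exists (\bigcup_(y in B) ball y d); first by apply: bigcup_open => y _; exact: ball_open.
  apply/seteqP; split=> [z Bz|z [Sz [y By yz]]]; last exact: step yz.
  by split; [apply: BS|exists z => //; apply: ballxx].
- exists (~` \bigcup_(y in S `\` B) ball y d).
    by apply: open_closedC; apply: bigcup_open => y _; exact: ball_open.
  apply/seteqP; split=> [z Bz|z [Sz nz]].
    split; first exact: BS.
    by move=> [y [Sy nBy] yz]; apply: nBy; apply: (step z y) => //; apply: ball_sym.
  by apply: contrapT => nBz; apply: nz; exists z => //; apply: ballxx.
Qed.

Lemma arc_dist (f g : R -> R * R) :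
  {within `[0, 1], continuous f} -> {within `[0, 1], continuous g} ->
  (forall s t, s \in `[0, 1] -> t \in `[0, 1] -> f s <> g t) ->
  exists2 d : R, 0 < d & forall s t, s \in `[0, 1] -> t \in `[0, 1] -> d <= `|f s - g t|.
Proof.
move=> cf cg fg.
have kf : compact (f @` `[0, 1]) by apply: continuous_compact cf _; apply: segment_compact.
have kg : compact (g @` `[0, 1]) by apply: continuous_compact cg _; apply: segment_compact.
have kfg := compact_setX kf kg.
pose h (z : (R * R) * (R * R)) := `|z.1 - z.2|.
have ch : continuous h.
  by move=> z; apply: cvg_norm; apply: cvgB; [apply: cvg_fst|apply: cvg_snd].
have I0 : (0 : R) \in `[0, 1] by rewrite in_itv /= lexx ler01.
have n0 : ((f @` `[0, 1]) `*` (g @` `[0, 1])) !=set0.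
  by exists (f 0, g 0); split; exists 0.
have [z + zmin] := compact_EVT_min n0 kfg (continuous_subspaceT ch).
rewrite inE => -[[s sI fs] [t tI gt]].
exists (h z).
  by rewrite /h normr_gt0 subr_eq0 -fs -gt; apply/eqP; apply: fg.
move=> s' t' s'I t'I; apply: (zmin (f s', g t')); rewrite inE; split; first by exists s'.
by exists t'.
Qed.

End Chains.

Section Drawing.
Variables (R : realType) (V : finType) (G : sgraph V).
Variables (pt : V -> R * R) (arc : {set V} -> R -> R * R).
Hypothesis dG : plane_drawing G pt arc.
Implicit Types (e f : {set V}) (s t : R) (u v : V).

Lemma arc_end e t : e \in edges G -> t \in `[0, 1] -> t \notin `]0, 1[ ->
  exists2 v, v \in e & arc e t = pt v.
Proof.
move=> eG t01 tn.
have h : [set 0; 1] t.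
  move: t01 tn; rewrite !in_itv /= => /andP[t0 t1]; rewrite negb_and -!leNgt => /orP[h|h].
    by left; apply/eqP; rewrite eq_le h.
  by right; apply/eqP; rewrite eq_le h t1.
have : (arc e @` [set 0; 1]) (arc e t) by exists t.
by rewrite (arc_ends dG eG) => -[v ve <-]; exists v.
Qed.

Lemma pt_on_arc e v : e \in edges G -> v \in e -> exists2 t, t \in `[0, 1] & arc e t = pt v.
Proof.
move=> eG ve; have : (pt @` [set` e]) (pt v) by exists v.
rewrite -(arc_ends dG eG) => -[t h <-]; exists t => //.
by case: h => ->; rewrite in_itv /= lexx ler01.
Qed.

Lemma disjoint_arcs e f s t : e \in edges G -> f \in edges G -> e :&: f == finset.set0 ->
  s \in `[0, 1] -> t \in `[0, 1] -> arc e s <> arc f t.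
Proof.
move=> eG fG ef sI tI.
case: (boolP (s \in `]0, 1[)) => hs; case: (boolP (t \in `]0, 1[)) => ht.
- apply: (arc_disjoint dG) => //; apply/eqP => E; rewrite E in ef.
  have : f != finset.set0 by rewrite -card_gt0 (edges_card2 fG).
  by move: ef; rewrite finset.setIid => ->.
- have [v vf ->] := arc_end fG tI ht; exact: (arc_avoids_pt dG).
- have [v vf ->] := arc_end eG sI hs; apply/nesym; exact: (arc_avoids_pt dG).
- have [v vf ->] := arc_end eG sI hs; have [w we ->] := arc_end fG tI ht.
  move=> /(pt_inj dG) E; rewrite E in vf.
  by move/eqP/setP/(_ w): ef; rewrite !inE we vf.
Qed.

Lemma drawing_gap : exists2 d : R, 0 < d & forall e f s t, e \in edges G -> f \in edges G ->
  e :&: f == finset.set0 -> s \in `[0, 1] -> t \in `[0, 1] -> 3 * d <= `|arc e s - arc f t|.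
Proof.
have /choice[D hD] : forall ef : {set V} * {set V}, exists d : R, 0 < d /\
   (ef.1 \in edges G -> ef.2 \in edges G -> ef.1 :&: ef.2 == finset.set0 ->
   forall s t, s \in `[0, 1] -> t \in `[0, 1] -> d <= `|arc ef.1 s - arc ef.2 t|).
  move=> [e f] /=; case: (boolP [&& e \in edges G, f \in edges G & e :&: f == finset.set0]) => [/and3P[eG fG ef]|n]; last first.
    exists 1; split => // eG fG ef; by move: n; rewrite eG fG ef.
  have [d d0 hd] := arc_dist (arc_continuous dG eG) (arc_continuous dG fG)
    (fun s t => @disjoint_arcs e f s t eG fG ef).
  by exists d.
exists ((\big[Num.min/1]_ef D ef) / 3).
  rewrite divr_gt0//; elim/big_ind: _ => // [x y x0 y0|ef _]; last by case: (hD ef).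
  by rewrite lt_min x0.
move=> e f s t eG fG ef sI tI; rewrite mulrC divfK//.
apply: (le_trans _ ((hD (e, f)).2 eG fG ef s t sI tI)).
by rewrite (bigD1 (e, f))//= ge_min lexx.
Qed.

Definition arcs_in (A : {set V}) : set (R * R) :=
  [set p | exists e t, [/\ e \in edges G, e \subset A, t \in `[0, 1] & arc e t = p]].

Lemma edge_chain d (A : {set V}) x y : 0 < d -> [set x; y]%SET \in edges G -> x \in A -> y \in A ->
  chain d (arcs_in A) (pt x) (pt y).
Proof.
move=> d0 xyG xA yA; set e := [set x; y]%SET.
have eA : e \subset A by apply/fintype.subsetP => z; rewrite !inE => /orP[]/eqP->.
apply: (@chain_sub _ _ (arc e @` `[0, 1])).
  by move=> p [t tI <-]; exists e, t.
have on z : z \in e -> (arc e @` `[0, 1]) (pt z).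
  by move=> ze; have [t tI <-] := pt_on_arc xyG ze; exists t.
apply: connected_chain => //; try by apply: on; rewrite !inE eqxx ?orbT.
apply: connected_continuous_connected; first exact: segment_connected.
exact: (arc_continuous dG).
Qed.

Lemma conn_chain d (B A : {set V}) x y : 0 < d -> B \subset A -> arcs_in A (pt y) ->
  connect (erel (edges G) B) x y -> chain d (arcs_in A) (pt x) (pt y).
Proof.
move=> d0 BA Ay /connectP[s]; elim: s x => [|z s IH] x /=.
  by move=> _ <-; exists [::]; split=> // p; rewrite inE => /eqP->.
move=> /andP[/and3P[xB zB xz] pz] yl.
apply: (chain_trans _ (IH z pz yl)).
by apply: edge_chain => //; apply: (fintype.subsetP BA).
Qed.

Lemma conn_on (B A : {set V}) x y : B \subset A -> arcs_in A (pt x) ->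
  connect (erel (edges G) B) x y -> arcs_in A (pt y).
Proof.
move=> BA Ax /connectP[s]; elim: s x Ax => [|z s IH] x Ax /=; first by move=> _ ->.
move=> /andP[/and3P[xB zB xz] pz] yl; apply: (IH z) => //.
have [t tI <-] := pt_on_arc xz (set22 x z).
exists [set x; z]%SET, t; split=> //.
by apply/fintype.subsetP => u; rewrite !inE => /orP[]/eqP->; apply: (fintype.subsetP BA).
Qed.

(* A walk inside the branch sets [B i] and [B j] is disjoint from a walk inside
   [B k] and [B l], so a minor is as good as a subdivision here. *)
Lemma no_K5_drawing (B : nat -> {set V}) :
  (forall i, (i < 5)%N -> conn (edges G) (B i)) ->
  (forall i j, (i < j < 5)%N -> B i :&: B j = finset.set0) ->
  (forall i j, (i < j < 5)%N -> touch (edges G) (B i) (B j)) -> False.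
Proof.
move=> cB dB tB; have [d d0 gap] := drawing_gap.
have Bn i : (i < 5)%N -> exists v, v \in B i.
  by move=> i5; have /connP[/set0Pn[v vB] _] := cB i i5; exists v.
have [x0 _] := Bn 0 isT.
pose r i := odflt x0 [pick v in B i].
have rB i : (i < 5)%N -> r i \in B i.
  by move=> /Bn[v vB]; rewrite /r; case: pickP => //= /(_ v); rewrite vB.
have walk i j : (i < j < 5)%N -> chain d (arcs_in (B i :|: B j)) (pt (r i)) (pt (r j)).
  move=> /[dup] ij /andP[i_j j5]; have i5 := ltn_trans i_j j5.
  have /touchP[x [y [xB yB xy]]] := tB i j ij.
  have xU : x \in B i :|: B j by rewrite inE xB.
  have yU : y \in B i :|: B j by rewrite inE yB orbT.
  have ec := edge_chain d0 xy xU yU.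
  have Ax : arcs_in (B i :|: B j) (pt x) by case: ec => s [_ _]; apply; apply: mem_head.
  have Ay : arcs_in (B i :|: B j) (pt y).
    by case: ec => s [_ <-]; apply; apply: mem_last.
  have c1 : chain d (arcs_in (B i :|: B j)) (pt (r i)) (pt x).
    apply: (@conn_chain _ (B i)) => //; first exact: finset.subsetUl.
    by have /connP[_] := cB i i5; apply; rewrite ?rB.
  apply: (chain_trans c1); apply: (chain_trans ec).
  have /connP[_ h] := cB j j5.
  have Aj : arcs_in (B i :|: B j) (pt (r j)).
    by apply: (@conn_on (B j) _ y) => //; [exact: finset.subsetUr|apply: h => //; apply: rB].
  apply: (@conn_chain _ (B j)) => //; last by apply: h => //; apply: rB.
  exact: finset.subsetUr.
pose w i j := if pselect ((i < j < 5)%N) is left h then sval (cid (walk i j h)) else [::].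
have wP i j : (i < j < 5)%N -> [/\ path (nearby d) (pt (r i)) (w i j), 
   last (pt (r i)) (w i j) = pt (r j) &
   forall x, x \in pt (r i) :: w i j -> arcs_in (B i :|: B j) x].
  by rewrite /w => ij; case: pselect => // h; case: cid.
apply: (@K5_obstruction _ d (pt \o r) w d0).
  by move=> i j /wP[].
move=> i j k l ij kl /and4P[ik il jk jl].
have [_ _ h1] := wP i j ij; have [_ _ h2] := wP k l kl.
apply/allP => y /h2[f [t [fG fA tI <-]]]; apply/allP => x /h1[e [s [eG eA sI <-]]].
rewrite distant_normE; apply: gap => //.
have dB' a b : (a < 5)%N -> (b < 5)%N -> a != b -> B a :&: B b = finset.set0.
  move=> a5 b5; rewrite neq_ltn => /orP[] ab; first by rewrite dB// ab.
  by rewrite finset.setIC dB// ab.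
have [i_j j5] := andP ij; have [k_l l5] := andP kl.
rewrite -finset.subset0; apply: (fintype.subset_trans (finset.setISS eA fA)).
rewrite finset.setIUl !finset.setIUr !dB' ?finset.setU0 ?fintype.subxx//.
all: by [apply: ltn_trans l5|apply: ltn_trans j5].
Qed.

End Drawing.

Lemma planar_sparse (R : realType) (V : finType) (G : sgraph V) :
  planar R G -> sparse (edges G).
Proof.
move=> [pt [arc dG]]; apply: contraT => /not_sparse_K5[s [P [ss sc sp _]]]; exfalso.
have /(pairwiseP finset.set0) h := sp; rewrite ss in h.
apply: (no_K5_drawing dG (B := nth finset.set0 s)).
- by move=> i i5; apply: (allP sc); rewrite mem_nth// ss.
- move=> i j /andP[ij j5]; have /andP[+ _] := h i j (ltn_trans ij j5) j5 ij.
  by move/disjoint_setI0.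
- by move=> i j /andP[ij j5]; have /andP[_ +] := h i j (ltn_trans ij j5) j5 ij.
Qed.

Lemma prob_planar_le (R : realType) (V : finType) (G : sgraph V) (p : R) :
  0 <= p <= 1 ->
  prob_subgraph p G (@planar R V) <= EE p (edges G) (fun F => (sparse F)%:R).
Proof.
move=> hp; rewrite /prob_subgraph /EE [leRHS](bigID (fun F => `[< planar R (edge_subgraph G F) >])) /=.
rewrite -[leLHS]addr0; apply: lerD.
  apply: ler_sum => F /andP[+ /asboolP/planar_sparse] /=.
  by rewrite powersetE => /finset.setIidPr -> ->; rewrite mulr1.
by apply: sumr_ge0 => F _; rewrite mulr_ge0// wt_ge0.
Qed.

(** * The limit *)

Lemma exists_nat_gt (R : realType) (x : R) : exists k : nat, x < k%:R.
Proof.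
exists (Num.bound `|x|); apply: le_lt_trans (ler_norm x) _.
by apply: archi_boundP.
Qed.

(** With [a] about [r / m], one [a] of the [3 * a + 3] neighbours given up pays for [K], one for
    [d], and the remainder for the share [1 / m] lost to bad vertices. *)
Lemma good_arith (r m a d K dd : nat) : (K <= a)%N -> (d <= a)%N ->
  (3 * a + 3 + dd = r)%N -> (r < a.+1 * m)%N -> (0 < m)%N ->
  (m * (dd + K + d) <= m.-1 * r)%N.
Proof. by case: m => // m' h1 h2 h3 h4 _; rewrite /=; nia. Qed.

(** Hubs number at most [2 * #|V| / M], so by the choice of [M] there are [16 * k1] near-hub
    vertices for each of them. There are also at least [d] hubs, which makes the bound at most
    [(1 / 2) ^+ d]. *)
Lemma many_near_hubs (R : realType) (V : finType) (E : {set {set V}}) (r M d D W k1 : nat) (p k : R) :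
  (forall v, (r <= #|nb E v|)%N) ->
  (forall u v, [set u; v]%SET \in E -> #|nb E u| = r \/ #|nb E v| = r) ->
  0 <= p <= 1 -> (0 < r)%N -> (66 <= d)%N -> (0 < D)%N ->
  d%:R * p <= 1 / 2 -> 1 <= (2 * D)%:R * (d%:R * p) ->
  (1 - 1 / (32 * D%:R ^+ 2) / 2) ^+ k1 <= 1 / 4 :> R ->
  (32 * k1 * W <= M)%N -> (#|V| < W * #|near_hubs E r M d|)%N ->
  0 < k -> 1 / (k * (1 / 2)) <= d%:R ->
  EE p E (fun F => (sparse F)%:R) <= k.
Proof.
move=> degr degmin p01 r0 d66 D0 dp Dp hk1 hM hV k0 kd.
have rate := hub_rate_bounds p01 d66 D0 dp Dp.
have /andP[_ rate1] := rate.
apply: le_trans (hub_case E r M p01 rate1) _.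
have n0 : near_hubs E r M d != finset.set0.
  by apply: contraTneq hV => ->; rewrite cards0 muln0.
have hd := hubs_ge n0.
have hh := card_hubs M degmin r0.
have c0 : 0 < 1 / (32 * D%:R ^+ 2) :> R by rewrite divr_gt0// mulr_gt0// exprn_gt0// ltr0n.
have ht : (16 * k1 * #|hubs E r M| <= #|near_hubs E r M d|)%N.
  have M0 : (0 < W)%N by move: hV; case: (W).
  move: hM hV hh M0; move: #|hubs _ _ _| #|near_hubs _ _ _ _| #|V| => h t n; clear.
  move=> h1 h2 h3 h4.
  have : (32 * k1 * W * h <= 2 * n)%N by apply: leq_trans h3; rewrite leq_mul2r h1 orbT.
  move=> h5; have : (W * (16 * k1 * h) <= W * t)%N by nia.
  by rewrite leq_pmul2l.
apply: le_trans (hub_power c0 rate hk1 ht) _.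
apply: (@le_trans _ _ ((1 / 2) ^+ d)).
  by apply: ler_wiXn2l => //; lra.
have -> : 1 / 2 = 1 - 1 / 2 :> R by lra.
by apply: pow_small => //; lra.
Qed.

(** All constants are fixed from [eps] and [k] alone, each after those it depends on, before any
    graph is considered. *)
Lemma sparse_prob_small (R : realType) (eps k : R) : 0 < eps -> 0 < k -> exists r0 : nat, forall r, (r0 <= r)%N ->
  forall (V : finType) (E0 : {set {set V}}), (forall e, e \in E0 -> #|e| = 2) ->
    (forall v, (r <= #|nb E0 v|)%N) -> (0 < #|V|)%N ->
    EE ((1 + eps) / r%:R) E0 (fun F => (sparse F)%:R) <= k.
Proof.
move=> eps0 k0.
pose b := Num.min eps 1 / 4.
have b0 : 0 < b by rewrite divr_gt0// lt_min eps0/=.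
have b1 : b <= 1 / 4 by rewrite ler_pM2r// ge_min lexx orbT.
have beps : 4 * b <= eps by rewrite mulrC divfK// ge_min lexx.
move: b b0 b1 beps => b b0 b1 beps.
pose g := b / (1 + b); pose c := g ^+ 2 / 64.
have g0 : 0 < g by apply: divr_gt0 => //; lra.
have c0 : 0 < c by rewrite divr_gt0// exprn_gt0.
have [K hK0] := exists_nat_gt (32 / (b * c)).
have bc0 : 0 < b * c by apply: mulr_gt0.
have hK : 32 < b * c * K%:R by rewrite [ltRHS]mulrC -ltr_pdivrMr.
have K0 : (0 < K)%N.
  by rewrite -(ltr_nat R); apply: le_lt_trans hK0; rewrite divr_ge0// ltW.
(* Together with [N5] this limits the loss of [3 * (r %/ m) + 3] neighbours to [b * r / 2], so that
   the mean [1 + 2 * b] drops to no less than [1 + b]. *)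
have [m hm] := exists_nat_gt (12 / b).
have m0 : (0 < m)%N by rewrite -(ltr_nat R); apply: le_lt_trans hm; rewrite divr_ge0// ltW.
have mb : 12 <= b * m%:R by rewrite mulrC -ler_pdivrMr// ltW.
have m48 : (48 <= m)%N.
  rewrite -(ler_nat R); have m0' : 0 <= m%:R :> R by []. nra.
(* If at most a share [1 / W] of the vertices is near hubs, then [bad K.+1] has at most a quarter of
   all vertices. *)
pose W := (4 * (1 + m) ^ K.+1)%N.
have [D1 hD1] := exists_nat_gt (2 * (1 + eps)).
(* With [d = r %/ D], the summand [m] gives [d <= r %/ m] and the summand [D1] gives
   [d * p <= 1 / 2]. *)
pose D := (m + D1)%N.
have hD : 2 * (1 + eps) <= D%:R.
  by apply: le_trans (ltW hD1) _; rewrite ler_nat leq_addl.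
have D0 : (0 < D)%N by rewrite addn_gt0 m0.
have DR0 : 0 < D%:R :> R by rewrite ltr0n.
pose z : R := 1 / (32 * D%:R ^+ 2) / 2.
have z01 : 0 < z <= 1.
  have D1' : 1 <= D%:R ^+ 2 :> R by rewrite expr_ge1// ler1n.
  have h : 0 < 32 * D%:R ^+ 2 :> R by lra.
  by rewrite divr_gt0 ?divr_gt0//= ler_pdivrMr// ler_pdivrMr//; lra.
have [k1 hk1'] := exists_nat_gt (1 / (1 / 4 * z)).
have hk1 : (1 - z) ^+ k1 <= 1 / 4 by apply: pow_small; rewrite // ltW.
pose M := (32 * k1 * W + 8)%N.
have M0 : 0 < M%:R :> R by rewrite ltr0n addn_gt0 orbT.
(* Bounds [(1 + (1 + 2 * b) / r) ^+ (M * r)] for all [r] at once. *)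
pose C : R := expR (2 * M%:R).
have C0 : 0 < C by apply: expR_gt0.
pose A := 60 * 32 * M%:R * K%:R ^+ 2 * C / k.
have [T hT0] := exists_nat_gt (A / g ^+ 2).
have g20 : 0 < g ^+ 2 by rewrite exprn_gt0.
have hT : A <= g ^+ 2 * T%:R by rewrite mulrC -ler_pdivrMr// ltW.
have KR0 : 0 < K%:R :> R by rewrite ltr0n.
have A0 : 0 <= A by rewrite divr_ge0 ?ltW// !mulr_gt0// exprn_gt0.
have T0 : (0 < T)%N.
  by rewrite -(ltr_nat R); apply: le_lt_trans hT0; rewrite divr_ge0// ltW.
have [N1 hN1] := exists_nat_gt (64 * T%:R / g ^+ 2).
have [N2 hN2] := exists_nat_gt ((1 + eps) * (T ^ 2)%:R).
have kg4 : 0 < k * g ^+ 4 by rewrite mulr_gt0// exprn_gt0.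
have [N3 hN3] := exists_nat_gt (24 * 32 ^+ 2 * K%:R ^+ 2 * M%:R ^+ 2 / (k * g ^+ 4)).
have kbc : 0 < k * b * c ^+ 2 by apply: mulr_gt0; [exact: mulr_gt0|exact: exprn_gt0].
have [N4 hN4] := exists_nat_gt (96 / (k * b * c ^+ 2)).
have [N5 hN5] := exists_nat_gt (12 / b).
have [N6 hN6] := exists_nat_gt (1 + eps).
have [N7 hN7] := exists_nat_gt (1 / (k * (1 / 2))).
exists (N1 + N2 + N3 + N4 + N5 + N6 + N7 * D + 66 * D + K * m)%N => r hr V E0 E02 deg0 V0.
have [r1 r3 r4 r5] : [/\ (N1 <= r)%N, (N2 <= r)%N, (N3 <= r)%N & (N4 <= r)%N].
  by move: hr; clear; move: (N7 * D)%N (66 * D)%N (K * m)%N => x y t; split; lia.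
have [r6 r7] : [/\ (N5 <= r)%N & (N6 <= r)%N].
  by move: hr; clear; move: (N7 * D)%N (66 * D)%N (K * m)%N => x y t; split; lia.
have [r8 r9 r10] : [/\ (N7 * D <= r)%N, (66 * D <= r)%N & (K * m <= r)%N].
  by move: hr; clear; move: (N7 * D)%N (66 * D)%N (K * m)%N => x y t; split; lia.
have r2 : (2 <= r)%N by apply: leq_trans r9; rewrite -[2%N]/(2 * 1)%N leq_mul.
have r0 : (0 < r)%N by apply: ltn_trans r2.
have rr0 : 0 < r%:R :> R by rewrite ltr0n.
have [E [EE0 degr degmin]] := minimal_subgraph deg0.
have E2 e : e \in E -> #|e| = 2 by move=> /(fintype.subsetP EE0)/E02.
(* Through this bound the thresholds [N3] and [N4] on [r] also serve as thresholds on [#|V|]. *)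
have rn : (r <= #|V|)%N.
  by have /card_gt0P[v _] := V0; apply: leq_trans (degr v) (max_card _).
set p := (1 + eps) / r%:R.
have rN (N : nat) (x : R) : x < N%:R -> (N <= r)%N -> x <= r%:R.
  by move=> /ltW xN Nr; apply: le_trans xN _; rewrite ler_nat.
have p1 : p <= 1 by rewrite ler_pdivrMr// mul1r (rN N6).
have p0 : 0 < p by rewrite divr_gt0// addr_gt0.
have p01 : 0 <= p <= 1 by rewrite ltW.
apply: (@le_trans _ _ (EE p E (fun F => (sparse F)%:R))).
  apply: EE_antimono => // F1 F2 FF; rewrite ler_nat.
  by case: (boolP (sparse F2)) => // /(sparse_sub FF) ->.
pose d := (r %/ D)%N; pose a := (r %/ m)%N.
have d66 : (66 <= d)%N by rewrite leq_divRL.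
have Ka : (K <= a)%N by rewrite leq_divRL.
have da : (d <= a)%N by apply: leq_div2l => //; apply: leq_addr.
have d0 : (0 < d)%N by apply: leq_trans d66.
have M2 : (2 <= M)%N by rewrite /M -addn2 -[8%N]/(6 + 2)%N addnA leq_addl.
have dD : d%:R * D%:R <= r%:R :> R by rewrite -natrM ler_nat leq_trunc_div.
have rD : r%:R <= (2 * D)%:R * d%:R :> R.
  rewrite -natrM ler_nat; apply: leq_trans (ltnW (ltn_ceil r D0)) _; rewrite -/d.
  by move: d0; clear; nia.
have dp : d%:R * p <= 1 / 2.
  rewrite /p mulrA ler_pdivrMr//.
  have dR0 : 0 <= d%:R :> R by [].
  have := ler_wpM2l dR0 hD; move: dD; clear; lra.
have Dp : 1 <= (2 * D)%:R * (d%:R * p).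
  rewrite /p !mulrA ler_pdivlMr// mul1r.
  apply: le_trans rD _; by rewrite ler_peMr ?mulr_ge0// lerDl ltW.
have [hW|hW] := leqP (W * #|near_hubs E r M d|)%N #|V|; last first.
  apply: (many_near_hubs degr degmin p01 r0 d66 D0 dp Dp hk1 _ hW k0); first by rewrite leq_addr.
  apply: le_trans (ltW hN7) _; by rewrite ler_nat leq_divRL.
pose dd := (r - (3 * a + 3))%N.
have am : (a * m <= r)%N by apply: leq_trunc_div.
have ma : (r < a.+1 * m)%N by apply: ltn_ceil.
have big : (r <= 2 * dd)%N.
  rewrite /dd; move: am m48 (leq_trans d66 da); clear; nia.
have ddle : (3 * a + 3 + dd = r)%N by rewrite subnKC//; move: am m48 (leq_trans d66 da); clear; nia.
have hgood : (m * (dd + K + d) <= m.-1 * r)%N.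
  exact: good_arith Ka da ddle ma m0.
have hdd : (1 + b) * r%:R <= dd%:R * (1 + 2 * b).
  have e1 : 3 * a%:R + 3 + dd%:R = r%:R :> R by rewrite -natrM -!natrD ddle.
  have e2 : a%:R * m%:R <= r%:R :> R by rewrite -natrM ler_nat.
  have e3 : 12 <= b * r%:R by rewrite mulrC -ler_pdivrMr// (rN N5).
  have e4 : 12 * a%:R <= b * r%:R.
    have a0 : 0 <= a%:R :> R by [].
    by apply: le_trans (ler_wpM2r a0 mb) _; rewrite -mulrA (mulrC m%:R) ler_wpM2l// ltW.
  by move: e1 e3 e4 b0 b1 rr0; clear; move: (a%:R) (dd%:R) (r%:R) => x y t e1 e3 e4 b0 b1 t0; nra.
have hhubs : (4 * #|hubs E r M| <= #|V|)%N.
  have M8 : (8 <= M)%N by apply: leq_addl.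
  have := leq_trans (leq_mul M8 (leqnn _)) (card_hubs M degmin r0).
  by move: #|hubs _ _ _| #|V| => x y; clear; lia.
have hbad : (4 * #|bad E r M d m K.+1| <= #|V|)%N.
  apply: leq_trans hW; rewrite /W -mulnA leq_mul2l /=; exact: card_bad.
apply: (@le_trans _ _ (EE p (hubless E r M) (fun F => (sparse F)%:R))).
  apply: EE_antimono => //.
    by apply/fintype.subsetP => e; rewrite inE => /andP[].
  move=> F1 F2 FF; rewrite ler_nat.
  by case: (boolP (sparse F2)) => // /(sparse_sub FF) ->.
have rnR : r%:R <= #|V|%:R :> R by rewrite ler_nat.
apply: (@no_hub_case R V E r M d m K T dd p b C k g c) => //.
- by rewrite ler_wpM2r ?invr_ge0 ?(ltW rr0)// lerD2l.
- by rewrite /p mulrAC ler_pdivrMr// mul1r (rN N2).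
- set q := (1 + 2 * b) / r%:R.
  have q0 : 0 <= q by rewrite divr_ge0 ?(ltW rr0)// addr_ge0// mulr_ge0// ltW.
  apply: (@le_trans _ _ (expR q ^+ (M * r))).
    by apply: lerXn2r; rewrite ?nnegrE ?expR_ge0 ?addr_ge0//; exact: expR_ge1Dx.
  rewrite -expRM_natl ler_expR.
  have -> : (M * r)%:R * q = (1 + 2 * b) * M%:R by rewrite natrM /q; field; rewrite gt_eqF.
  by rewrite ler_pM2r//; move: b1; clear; lra.
- by rewrite [leRHS]mulrC -ler_pdivrMr//; apply: (rN N1).
- by rewrite [leRHS]mulrC -ler_pdivrMr//; apply: le_trans rnR; apply: (rN N3).
- by rewrite [leRHS]mulrC -ler_pdivrMr//; apply: le_trans rnR; apply: (rN N4).
Qed.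

Lemma min_degree_nb (V : finType) (G : sgraph V) v : (min_degree G <= #|nb (edges G) v|)%N.
Proof.
apply: (@leq_trans (degree G v)).
  rewrite /min_degree; have := mem_index_enum v; elim: (index_enum V) => // w s IH.
  rewrite inE big_cons => /orP[/eqP->|/IH h]; first exact: geq_minl.
  exact: leq_trans (geq_minr _ _) h.
rewrite /degree.
apply: (@leq_trans #|star v (nb (edges G) v)|); last exact: leq_imset_card.
apply/subset_leq_card/fintype.subsetP => e; rewrite inE => /andP[eG ve].
have /eqP/cards2P[x [y [_ exy]]] := edges_card2 eG.
move: ve eG; rewrite exy !inE => /orP[]/eqP-> eG; apply/imsetP.
  by exists y; rewrite ?inE.
by exists x; rewrite ?inE finset.setUC.
Qed.

Lemma min_degree_card (V : finType) (G : sgraph V) : (min_degree G <= #|V|)%N.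
Proof.
rewrite /min_degree; elim/big_rec: _ => // v x _ h; exact: leq_trans (geq_minr _ _) h.
Qed.

Theorem theorem1 (R : realType) (eps : R) (eps_gt0 : 0 < eps) :
  exists theta : nat -> R,
    theta r @[r --> \oo] --> (0 : R) /\
    forall r : nat, 1 + eps <= r%:R ->
    forall (V : finType) (G : sgraph V), min_degree G = r ->
      prob_subgraph ((1 + eps) / r%:R) G (@planar R V) <= theta r.
Proof.
pose P r x := exists (V : finType) (G : sgraph V), min_degree G = r /\
  x = prob_subgraph ((1 + eps) / r%:R) G (@planar R V).
(* A supremum over all graphs depends on [r] alone; the value 0 outside the range of [r] does not
   disturb the limit. *)
pose theta (r : nat) : R := if 1 + eps <= r%:R then sup [set x | P r x] else 0.
have p01 (r : nat) : 1 + eps <= r%:R -> 0 <= (1 + eps) / r%:R <= 1.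
  move=> h; have r0 : 0 < r%:R :> R by apply: lt_le_trans h; lra.
  by rewrite ler_pdivrMr// mul1r h andbT divr_ge0// ltW//; lra.
have P01 r x : 1 + eps <= r%:R -> P r x -> 0 <= x <= 1.
  move=> /p01 hp [V [G [_ ->]]]; apply/andP; split.
    by apply: sumr_ge0 => F _; apply: wt_ge0.
  apply: le_trans (prob_planar_le G hp) _; rewrite -[leRHS](EE_cst ((1 + eps) / r%:R) (edges G)).
  by apply: EE_le => // F _; case: sparse.
have bnd r : 1 + eps <= r%:R -> has_ubound [set x | P r x].
  by move=> h; exists 1 => x /(P01 r x h)/andP[].
exists theta; split; last first.
  move=> r hr V G mG; rewrite /theta hr; apply: ub_le_sup; first exact: bnd.
  by exists V, G.
apply/cvgrPdist_le => e e0; have [r0 hr0] := sparse_prob_small eps_gt0 e0.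
near=> r; rewrite sub0r normrN /theta.
case: ifP => [hr|_]; last by rewrite normr0 ltW.
have r_gt0 : (0 < r)%N by rewrite -(ltr_nat R); apply: lt_le_trans hr; lra.
have r_ge : (r0 <= r)%N by near: r; exact: nbhs_infty_ge.
have [->|/set0P[x Px]] := eqVneq [set x | P r x] set0; first by rewrite sup0 normr0 ltW.
rewrite ger0_norm; last first.
  by apply: le_trans (ub_le_sup (bnd r hr) Px); have /andP[] := P01 r x hr Px.
apply: ge_sup; first by exists x.
move=> y [V [G [mG ->]]]; apply: le_trans (prob_planar_le G (p01 r hr)) _.
apply: hr0 => //.
- by move=> e'; apply: edges_card2.
- by move=> v; rewrite -mG min_degree_nb.
(* The graph without vertices is excluded because its minimum degree is 0. *)
- by apply: leq_trans r_gt0 _; rewrite -mG min_degree_card.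
Unshelve. all: by end_near. Qed.
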